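(* The lattice $\varphi_\beta(\mathcal{M})\subset\mathbb{R}^n$, with $\beta=p^{-2}\left(\frac1k-\frac{\theta}{2k}\right)$, is a rotated version of $D_n$, i.e. it equals $D_nQ$ for some real orthogonal $n\times n$ matrix $Q$.
   Context: Let $l>1$ be odd and $p$ a prime with $p\equiv1\pmod l$; let $\zeta_p=e^{2\pi i/p}$, $r$ a primitive root mod $p$, $\sigma\in\mathrm{Gal}(\mathbb{Q}(\zeta_p)/\mathbb{Q})$ with $\sigma(\zeta_p)=\zeta_p^r$, $\mathbb{K}=\{y\in\mathbb{Q}(\zeta_p):\sigma^l(y)=y\}$ (totally real, degree $l$). Let $\alpha=\prod_{j=0}^{(p-3)/2}(1-\zeta_p^{r^j})$, $\lambda$ an integer with $\lambda(r-1)\equiv1\pmod p$, $z=\zeta_p^\lambda\alpha(1-\zeta_p)$, $x=\sum_{j=1}^{(p-1)/l}\sigma^{jl}(z)\in\mathcal{O}_\mathbb{K}$. Let $m\ge3$, $k=2^{m-2}$, $\omega=e^{2\pi i/2^m}$, $\theta_j=\omega^j+\omega^{-j}$, $\theta=\theta_1$, $\mathbb{L}=\mathbb{Q}(\theta)$ (totally real, degree $k$), $w_0=1$, $w_i=1+\theta_1+\dots+\theta_i$ ($1\le i\le k-1$). Let $n=kl$ and $\mathbb{KL}\subset\mathbb{R}$ the compositum, totally real of degree $n$, whose $n$ real embeddings are obtained by combining the embeddings $\sigma^i|_\mathbb{K}$ ($0\le i<l$) and $\tau^j$ ($0\le j<k$), $\tau$ a generator of $\mathrm{Gal}(\mathbb{L}/\mathbb{Q})$.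 For totally positive $\beta\in\mathbb{KL}$, $\varphi_\beta(y)=(\sqrt{\rho(\beta)}\rho(y))_\rho\in\mathbb{R}^n$, $\rho$ running over the embeddings in a fixed order. Let $\mathcal{M}$ be the $\mathbb{Z}$-module generated by $w_0(x+\sigma(x))$; the elements $w_i\sigma^{l-1}(x)-w_{i+1}x$ for $0\le i\le k-2$; and the elements $w_j(\sigma^i(x)-\sigma^{i+1}(x))$ for $0\le j\le k-1$, $0\le i\le l-2$. $D_n=\{y\in\mathbb{Z}^n:\sum y_i\text{ even}\}$. *)

(* Defs.v *)
From Stdlib Require Import Reals ZArith Arith List Znumtheory.
Open Scope R_scope.

Definition rsum (N : nat) (f : nat -> R) : R :=
  fold_right Rplus 0 (map f (seq 0 N)).

Definition Cx := (R * R)%type.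
Definition Cadd (u v : Cx) : Cx := (fst u + fst v, snd u + snd v).
Definition Csub (u v : Cx) : Cx := (fst u - fst v, snd u - snd v).
Definition Cmul (u v : Cx) : Cx :=
  (fst u * fst v - snd u * snd v, fst u * snd v + snd u * fst v).
Definition C1 : Cx := (1, 0).
Definition C0 : Cx := (0, 0).
Definition Csum (N : nat) (f : nat -> Cx) : Cx :=
  fold_right Cadd C0 (map f (seq 0 N)).
Definition Cprod (N : nat) (f : nat -> Cx) : Cx :=
  fold_right Cmul C1 (map f (seq 0 N)).

Definition zeta_pow (p : nat) (e : Z) : Cx :=
  (cos (2 * PI * IZR e / INR p), sin (2 * PI * IZR e / INR p)).

(** sigma^s(z), where sigma(zeta_p) = zeta_p^r and
    z = zeta_p^lam * prod_{j=0}^{(p-3)/2} (1 - zeta_p^{r^j}) * (1 - zeta_p) *)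
Definition sigma_z (p : nat) (r lam : Z) (s : nat) : Cx :=
  Cmul (Cmul (zeta_pow p (lam * r ^ Z.of_nat s))
             (Cprod ((p - 3) / 2 + 1)%nat
                (fun j => Csub C1 (zeta_pow p (r ^ Z.of_nat (j + s))))))
       (Csub C1 (zeta_pow p (r ^ Z.of_nat s))).

(** sigma^t(x), x = sum_{j=1}^{(p-1)/l} sigma^{jl}(z).  x lies in the totally
    real field K, so this complex number is real; we take its real part. *)
Definition sigma_x (p l : nat) (r lam : Z) (t : nat) : R :=
  fst (Csum ((p - 1) / l)%nat (fun j => sigma_z p r lam (t + (j + 1) * l)%nat)).

(** tau^b(theta_j) = 2 cos(2 pi j 5^b / 2^m), tau : omega |-> omega^5 a
    generator of Gal(L/Q) *)
Definition tau_theta (m j b : nat) : R :=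
  2 * cos (2 * PI * INR j * INR (5 ^ b) / INR (2 ^ m)).

Definition tau_w (m i b : nat) : R :=
  1 + rsum i (fun j => tau_theta m (j + 1) b).

Definition kk (m : nat) : nat := 2 ^ (m - 2).
Definition nn (m l : nat) : nat := (kk m * l)%nat.

Definition tau_beta (p m b : nat) : R :=
  / (INR p ^ 2) * (/ INR (kk m) - tau_theta m 1 b / (2 * INR (kk m))).

(** The n real embeddings of KL are rho_{a,b} = (sigma^a|_K , tau^b),
    0 <= a < l, 0 <= b < k; the coordinate index is idx = a*k + b.
    An element y of KL is given through ev a b = rho_{a,b}(y).
    phi_beta(y) as a vector (coordinates >= n set to 0). *)
Definition phi_beta (p l m : nat) (ev : nat -> nat -> R) : nat -> R :=
  fun idx => if Nat.ltb idx (nn m l)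
             then sqrt (tau_beta p m (idx mod kk m)%nat) *
                  ev (idx / kk m)%nat (idx mod kk m)%nat
             else 0.

Definition gen1 (p l m : nat) (r lam : Z) : nat -> nat -> R :=
  fun a b => tau_w m 0 b * (sigma_x p l r lam a + sigma_x p l r lam (a + 1)).
Definition gen2 (p l m : nat) (r lam : Z) (i : nat) : nat -> nat -> R :=
  fun a b => tau_w m i b * sigma_x p l r lam (a + (l - 1)) -
             tau_w m (i + 1) b * sigma_x p l r lam a.
Definition gen3 (p l m : nat) (r lam : Z) (j i : nat) : nat -> nat -> R :=
  fun a b => tau_w m j b * (sigma_x p l r lam (a + i) - sigma_x p l r lam (a + i + 1)).

Definition gen_vec (p l m : nat) (r lam : Z) (v : nat -> R) : Prop :=
  v = phi_beta p l m (gen1 p l m r lam)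
  \/ (exists i, (i + 2 <= kk m)%nat /\ v = phi_beta p l m (gen2 p l m r lam i))
  \/ (exists j i, (j + 1 <= kk m)%nat /\ (i + 2 <= l)%nat /\
                  v = phi_beta p l m (gen3 p l m r lam j i)).

Inductive Zspan (G : (nat -> R) -> Prop) : (nat -> R) -> Prop :=
| Zspan0 : Zspan G (fun _ => 0)
| Zspan_gen : forall v, G v -> Zspan G v
| Zspan_add : forall u v, Zspan G u -> Zspan G v -> Zspan G (fun i => u i + v i)
| Zspan_opp : forall v, Zspan G v -> Zspan G (fun i => - v i).

Definition in_Dn (n : nat) (d : nat -> Z) : Prop :=
  Z.Even (fold_right Z.add 0%Z (map d (seq 0 n))).

Definition vec_mul (n : nat) (d : nat -> Z) (Q : nat -> nat -> R) : nat -> R :=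
  fun j => if Nat.ltb j n then rsum n (fun i => IZR (d i) * Q i j) else 0.

Definition orthogonal (n : nat) (Q : nat -> nat -> R) : Prop :=
  forall i j, (i < n)%nat -> (j < n)%nat ->
    rsum n (fun t => Q i t * Q j t) = if Nat.eqb i j then 1 else 0.

Definition prim_root (p : nat) (r : Z) : Prop :=
  (r mod Z.of_nat p <> 0)%Z /\
  forall t : nat, (0 < t < p - 1)%nat -> (r ^ Z.of_nat t mod Z.of_nat p <> 1)%Z.

(* Main.v *)
(** Write e_(i,j) = phi_beta(w_j sigma^i(x)).  These n vectors are orthonormal, because
    their inner products are products of two trace forms:
    - with t = pi 5^b / 2^m, tau^b(w_i) sin(t) = sin((2i+1)t) and tau^b(1 - theta/2) =
      2 sin(t)^2, so sum_b tau^b(beta w_i w_j) reduces to the sums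
      sum_b cos(2 pi s 5^b / 2^m), which vanish when 2^(m-2) does not divide s;
    - A = zeta^lam alpha satisfies sigma(A) = -A and |A|^2 = N(1 - zeta) = p, so
      sigma^t(x) = -A sum_j (-1)^s zeta^(r^s) with s = t + j l, and the sum over a of
      sigma^(a+i)(x) sigma^(a+i')(x) becomes a signed combination of the sums
      sum_u zeta^(c r^u), which are p - 1 or -1.
    Listing the e_(i,j) in the order j l + i, the generators of M are e_0 + e_1 and the
    consecutive differences e_q - e_(q+1), which generate D_n. *)

Require Import Defs.
From Stdlib Require Import Reals ZArith Arith List Znumtheory.
From Stdlib Require Import Lra Lia Permutation FunctionalExtensionality.
(* [Reals] exports another [C1]. *)
Import Defs.
Open Scope R_scope.

(** * Finite sums and the lattice D_n *)

(** The folds peel off the first index, whereas inductions on the length peel off the last one. One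
    proof for any monoid serves [rsum], [Zsum], [Csum] and [Cprod]. *)
Lemma fold_right_seq_S {A : Type} (op : A -> A -> A) (e : A) (f : nat -> A) (n : nat) :
  (forall x y z, op x (op y z) = op (op x y) z) ->
  (forall x, op e x = x) -> (forall x, op x e = x) ->
  fold_right op e (map f (seq 0 (S n))) = op (fold_right op e (map f (seq 0 n))) (f n).
Proof.
  intros Hassoc Hl Hr.
  rewrite seq_S, map_app; simpl map.
  induction (map f (seq 0 n)) as [|x s IH]; simpl.
  - now rewrite Hl, Hr.
  - now rewrite IH, Hassoc.
Qed.

Lemma rsum_S (n : nat) (f : nat -> R) : rsum (S n) f = rsum n f + f n.
Proof. apply fold_right_seq_S; intros; ring. Qed.

Lemma rsum_ext (n : nat) (f g : nat -> R) :
  (forall i, (i < n)%nat -> f i = g i) -> rsum n f = rsum n g.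
Proof.
  induction n as [|n IH]; intros H; [reflexivity|].
  rewrite !rsum_S, IH, H; auto.
Qed.

Lemma rsum_plus (n : nat) (f g : nat -> R) :
  rsum n (fun i => f i + g i) = rsum n f + rsum n g.
Proof.
  induction n as [|n IH]; [unfold rsum; simpl; ring|].
  rewrite !rsum_S, IH; ring.
Qed.

Lemma rsum_scal (n : nat) (c : R) (f : nat -> R) :
  rsum n (fun i => c * f i) = c * rsum n f.
Proof.
  induction n as [|n IH]; [unfold rsum; simpl; ring|].
  rewrite !rsum_S, IH; ring.
Qed.

Lemma rsum_scal_r (n : nat) (c : R) (f : nat -> R) :
  rsum n (fun i => f i * c) = rsum n f * c.
Proof.
  rewrite Rmult_comm, <- rsum_scal; apply rsum_ext; intros; ring.
Qed.

Lemma rsum_const (n : nat) (c : R) : rsum n (fun _ => c) = INR n * c.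
Proof.
  induction n as [|n IH]; [unfold rsum; simpl; ring|].
  rewrite rsum_S, IH, S_INR; ring.
Qed.

Lemma rsum_0 (n : nat) (f : nat -> R) :
  (forall i, (i < n)%nat -> f i = 0) -> rsum n f = 0.
Proof.
  intros H; rewrite (rsum_ext n f (fun _ => 0) H), rsum_const; ring.
Qed.

Lemma rsum_exchange (n k : nat) (f : nat -> nat -> R) :
  rsum n (fun i => rsum k (f i)) = rsum k (fun j => rsum n (fun i => f i j)).
Proof.
  induction n as [|n IH].
  - symmetry; now apply rsum_0.
  - rewrite rsum_S, IH, <- rsum_plus.
    apply rsum_ext; intros; now rewrite rsum_S.
Qed.

Lemma rsum_add (a b : nat) (f : nat -> R) :
  rsum (a + b) f = rsum a f + rsum b (fun j => f (a + j)%nat).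
Proof.
  induction b as [|b IH].
  - rewrite Nat.add_0_r; unfold rsum at 3; simpl; ring.
  - rewrite Nat.add_succ_r, !rsum_S, IH; ring.
Qed.

Lemma rsum_mul (a b : nat) (f : nat -> R) :
  rsum (a * b) f = rsum a (fun i => rsum b (fun j => f (i * b + j)%nat)).
Proof.
  induction a as [|a IH]; [reflexivity|].
  rewrite rsum_S, <- IH, <- rsum_add.
  now replace (S a * b)%nat with (a * b + b)%nat by lia.
Qed.

Lemma rsum_delta (n q : nat) (c : R) :
  (q < n)%nat -> rsum n (fun i => if Nat.eqb i q then c else 0) = c.
Proof.
  induction n as [|n IH]; intros Hq; [lia|].
  rewrite rsum_S; destruct (Nat.eqb_spec n q) as [<-|Hn].
  - rewrite rsum_0; [ring|].
    intros i Hi; destruct (Nat.eqb_spec i n); [lia|reflexivity].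
  - rewrite IH; [ring|lia].
Qed.

(** The two sums differ by the telescoping quantity f(n) - f(0). This expresses cyclic invariance of
    a sum over one period. *)
Lemma rsum_shift (n : nat) (f : nat -> R) :
  f n = f 0%nat -> rsum n (fun i => f (S i)) = rsum n f.
Proof.
  intros H.
  assert (E : forall k, rsum k (fun i => f (S i)) + f 0%nat = rsum k f + f k).
  { induction k as [|k IH]; [reflexivity|rewrite !rsum_S; lra]. }
  specialize (E n); lra.
Qed.

Lemma rsum_alternating (n : nat) : rsum (2 * n) (fun j => (-1) ^ j) = 0.
Proof.
  rewrite Nat.mul_comm, rsum_mul; apply rsum_0; intros i _.
  rewrite !rsum_S; unfold rsum; simpl.
  replace (i * 2 + 1)%nat with (S (i * 2 + 0)) by lia; simpl; ring.
Qed.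

Lemma Zspan_scal (G : (nat -> R) -> Prop) (c : Z) (v : nat -> R) :
  Zspan G v -> Zspan G (fun i => IZR c * v i).
Proof.
  intros Hv.
  assert (Hnat : forall k : nat, Zspan G (fun i => INR k * v i)).
  { induction k as [|k IH].
    - replace (fun i => INR 0 * v i) with (fun _ : nat => 0); [constructor|].
      apply functional_extensionality; intros; simpl; ring.
    - replace (fun i => INR (S k) * v i) with (fun i => INR k * v i + v i);
        [now apply Zspan_add|].
      apply functional_extensionality; intros; rewrite S_INR; ring. }
  destruct (Z.le_ge_cases 0 c) as [Hc|Hc].
  - specialize (Hnat (Z.to_nat c)).
    now rewrite INR_IZR_INZ, Z2Nat.id in Hnat.
  - specialize (Hnat (Z.to_nat (- c))).
    rewrite INR_IZR_INZ, Z2Nat.id in Hnat by lia.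
    replace (fun i => IZR c * v i) with (fun i => - (IZR (- c) * v i));
      [now apply Zspan_opp|].
    apply functional_extensionality; intros; rewrite opp_IZR; ring.
Qed.

(** Cut off at [n] exactly as [vec_mul] and [phi_beta] are, so that vectors can be compared as
    functions on all of [nat]. *)
Definition row (n : nat) (Q : nat -> nat -> R) (q : nat) : nat -> R :=
  fun j => if Nat.ltb j n then Q q j else 0.

Definition Zsum (n : nat) (d : nat -> Z) : Z := fold_right Z.add 0%Z (map d (seq 0 n)).

Lemma Zsum_S (n : nat) (d : nat -> Z) : Zsum (S n) d = (Zsum n d + d n)%Z.
Proof. apply fold_right_seq_S; intros; ring. Qed.

Lemma IZR_Zsum (n : nat) (d : nat -> Z) : IZR (Zsum n d) = rsum n (fun i => IZR (d i)).
Proof.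
  induction n as [|n IH]; [reflexivity|].
  now rewrite Zsum_S, rsum_S, plus_IZR, IH.
Qed.

Lemma Zsum_add (n : nat) (d d' : nat -> Z) :
  Zsum n (fun i => d i + d' i)%Z = (Zsum n d + Zsum n d')%Z.
Proof. induction n as [|n IH]; [reflexivity|rewrite !Zsum_S, IH; ring]. Qed.

Lemma Zsum_opp (n : nat) (d : nat -> Z) :
  Zsum n (fun i => - d i)%Z = (- Zsum n d)%Z.
Proof. induction n as [|n IH]; [reflexivity|rewrite !Zsum_S, IH; ring]. Qed.

Lemma Zspan_rsum (G : (nat -> R) -> Prop) (n : nat) (d : nat -> Z) (E : nat -> nat -> R) :
  (forall q, (q < n)%nat -> Zspan G (E q)) ->
  Zspan G (fun j => rsum n (fun q => IZR (d q) * E q j)).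
Proof.
  induction n as [|n IH]; intros H.
  - apply Zspan0.
  - replace (fun j => rsum (S n) (fun q => IZR (d q) * E q j))
      with (fun j => rsum n (fun q => IZR (d q) * E q j) + IZR (d n) * E n j).
    + apply Zspan_add; [apply IH; auto|apply Zspan_scal; auto].
    + apply functional_extensionality; intros; now rewrite rsum_S.
Qed.

(** The vectors e_0 + e_1 and e_q - e_(q+1) form a system of generators of D_n; the matrix [Q] only
    transports this fact to the rows. *)
Lemma Zspan_Dn (n : nat) (Q : nat -> nat -> R) (G : (nat -> R) -> Prop) :
  (2 <= n)%nat ->
  (forall v, G v <-> v = (fun j => row n Q 0 j + row n Q 1 j) \/
     exists q, (S q < n)%nat /\ v = (fun j => row n Q q j - row n Q (S q) j)) ->
  forall v, Zspan G v <-> exists d, in_Dn n d /\ v = vec_mul n d Q.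
Proof.
  intros Hn HG v; split.
  - intros H; induction H as [|v Hv|u v _ [d [Hd ->]] _ [d' [Hd' ->]]|v _ [d [Hd ->]]].
    + exists (fun _ => 0%Z); split.
      * exists 0%Z; change (Zsum n (fun _ => 0%Z) = 0%Z).
        apply eq_IZR; rewrite IZR_Zsum; now apply rsum_0.
      * apply functional_extensionality; intros j; unfold vec_mul.
        destruct (j <? n)%nat; [|reflexivity].
        symmetry; apply rsum_0; intros; ring.
    + apply HG in Hv.
      (* Every generator has the form e_q + c e_q' with c = 1 or c = -1, so its coefficient sum 1 +
         c is 2 or 0, hence even. *)
      assert (Hdelta : forall (q q' : nat) (c : Z), (q < n)%nat -> (q' < n)%nat ->
        let d := fun i => ((if Nat.eqb i q then 1 else 0) + (if Nat.eqb i q' then c else 0))%Z in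
        Zsum n d = (1 + c)%Z /\
        vec_mul n d Q = (fun j => row n Q q j + IZR c * row n Q q' j)).
      { intros q q' c Hq Hq' d; split.
        - apply eq_IZR; rewrite IZR_Zsum, plus_IZR.
          rewrite (rsum_ext n _ (fun i => (if Nat.eqb i q then 1 else 0) +
                                        (if Nat.eqb i q' then IZR c else 0))).
          + rewrite rsum_plus, !rsum_delta; auto.
          + intros i _; unfold d; rewrite plus_IZR.
            now destruct (i =? q)%nat, (i =? q')%nat.
        - apply functional_extensionality; intros j; unfold vec_mul, row.
          destruct (j <? n)%nat; [|ring].
          rewrite (rsum_ext n _ (fun i => (if Nat.eqb i q then Q q j else 0) +
                                        (if Nat.eqb i q' then IZR c * Q q' j else 0))).
          + rewrite rsum_plus, !rsum_delta; auto.
          + intros i _; unfold d; rewrite plus_IZR.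
            destruct (Nat.eqb_spec i q), (Nat.eqb_spec i q'); subst; ring. }
      destruct Hv as [->|[q [Hq ->]]].
      * destruct (Hdelta 0%nat 1%nat 1%Z) as [H1 H2]; try lia.
        eexists; split; [exists 1%Z; exact H1|]; etransitivity; [|symmetry; exact H2].
        apply functional_extensionality; intros; ring.
      * destruct (Hdelta q (S q) (-1)%Z) as [H1 H2]; try lia.
        eexists; split; [exists 0%Z; exact H1|]; etransitivity; [|symmetry; exact H2].
        apply functional_extensionality; intros; ring.
    + exists (fun i => d i + d' i)%Z; split.
      * change (Z.Even (Zsum n (fun i => d i + d' i)%Z)); rewrite Zsum_add.
        destruct Hd as [c Hc], Hd' as [c' Hc']; fold (Zsum n d) in Hc; fold (Zsum n d') in Hc'.
        exists (c + c')%Z; lia.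
      * apply functional_extensionality; intros j; unfold vec_mul.
        destruct (j <? n)%nat; [|ring].
        rewrite <- rsum_plus; apply rsum_ext; intros; rewrite plus_IZR; ring.
    + exists (fun i => - d i)%Z; split.
      * change (Z.Even (Zsum n (fun i => - d i)%Z)); rewrite Zsum_opp.
        destruct Hd as [c Hc]; fold (Zsum n d) in Hc.
        exists (- c)%Z; lia.
      * apply functional_extensionality; intros j; unfold vec_mul.
        destruct (j <? n)%nat; [|ring].
        replace (- rsum n (fun i => IZR (d i) * Q i j))
          with (-1 * rsum n (fun i => IZR (d i) * Q i j)) by ring.
        rewrite <- rsum_scal; apply rsum_ext; intros; rewrite opp_IZR; ring.
  - intros [d [[c Hc] ->]]; fold (Zsum n d) in Hc.
    (* Consecutive differences telescope to e_q - e_0. *)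
    assert (Hdiff : forall q, (q < n)%nat ->
      Zspan G (fun j => row n Q q j - row n Q 0 j)).
    { induction q as [|q IH]; intros Hq.
      - replace (fun j => row n Q 0 j - row n Q 0 j) with (fun _ : nat => 0);
          [constructor|apply functional_extensionality; intros; ring].
      - replace (fun j => row n Q (S q) j - row n Q 0 j)
          with (fun j => (row n Q q j - row n Q 0 j) +
                         - (row n Q q j - row n Q (S q) j));
          [|apply functional_extensionality; intros; ring].
        apply Zspan_add; [apply IH; lia|apply Zspan_opp, Zspan_gen, HG].
        right; now exists q. }
    assert (H2 : Zspan G (fun j => 2 * row n Q 0 j)).
    { replace (fun j => 2 * row n Q 0 j)
        with (fun j => (row n Q 0 j + row n Q 1 j) + - (row n Q 1 j - row n Q 0 j));
        [|apply functional_extensionality; intros; ring].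
      apply Zspan_add; [apply Zspan_gen, HG; now left|apply Zspan_opp, Hdiff; lia]. }
    (* When the coefficients sum to 2c, subtracting e_0 from each e_q leaves exactly c times 2 e_0
       to be added back. *)
    replace (vec_mul n d Q)
      with (fun j => rsum n (fun q => IZR (d q) * (row n Q q j - row n Q 0 j)) +
                     IZR c * (2 * row n Q 0 j)).
    + apply Zspan_add; [|now apply Zspan_scal].
      now apply Zspan_rsum with (E := fun q j => row n Q q j - row n Q 0 j).
    + apply functional_extensionality; intros j; unfold vec_mul, row.
      destruct (j <? n)%nat.
      * rewrite (rsum_ext n _ (fun q => IZR (d q) * Q q j + IZR (d q) * - Q 0%nat j))
          by (intros; ring).
        rewrite rsum_plus, rsum_scal_r, <- IZR_Zsum, Hc, mult_IZR; ring.
      * rewrite rsum_0; intros; ring.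
Qed.

(** * The cyclotomic field of 2-power conductor *)

Lemma cos_period_Z (x : R) (k : Z) : cos (x + 2 * IZR k * PI) = cos x.
Proof.
  destruct (Z.le_ge_cases 0 k) as [Hk|Hk].
  - rewrite <- (Z2Nat.id k), <- INR_IZR_INZ by lia; apply cos_period.
  - rewrite <- (cos_period (x + 2 * IZR k * PI) (Z.to_nat (- k))).
    rewrite INR_IZR_INZ, Z2Nat.id, opp_IZR by lia; f_equal; ring.
Qed.

Lemma sin_period_Z (x : R) (k : Z) : sin (x + 2 * IZR k * PI) = sin x.
Proof.
  rewrite <- !cos_shift.
  replace (PI / 2 - (x + 2 * IZR k * PI)) with (PI / 2 - x + 2 * IZR (- k) * PI)
    by (rewrite opp_IZR; ring).
  apply cos_period_Z.
Qed.

Lemma cos_odd_PI (x : R) (k : Z) : cos (x + (2 * IZR k + 1) * PI) = - cos x.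
Proof.
  replace (x + (2 * IZR k + 1) * PI) with (x + PI + 2 * IZR k * PI) by ring.
  now rewrite cos_period_Z, neg_cos.
Qed.

Lemma pow5_odd (b : nat) : exists d, (5 ^ Z.of_nat b = 2 * d + 1)%Z.
Proof.
  induction b as [|b [d Hd]]; [now exists 0%Z|].
  rewrite Nat2Z.inj_succ, Z.pow_succ_r, Hd by lia; exists (5 * d + 2)%Z; ring.
Qed.

(** By repeated squaring: with M = 2^(j+2) and o odd, (1 + M o)^2 = 1 + 2M (o + (M/2) o^2), and M/2
    is even. The oddness of the cofactor is what later produces a half turn. *)
Lemma pow5_pow2 (j : nat) :
  exists c : Z, (5 ^ Z.of_nat (2 ^ j) = 1 + 2 ^ (Z.of_nat j + 2) * (2 * c + 1))%Z.
Proof.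
  induction j as [|j [c Hc]].
  - now exists 0%Z.
  - replace (Z.of_nat (2 ^ S j)) with (Z.of_nat (2 ^ j) * 2)%Z
      by (rewrite Nat.pow_succ_r'; lia).
    rewrite Z.pow_mul_r, Hc by lia.
    replace (Z.of_nat (S j) + 2)%Z with (Z.of_nat j + 2 + 1)%Z by lia.
    rewrite (Z.pow_add_r 2 (Z.of_nat j + 2)) by lia.
    rewrite (Z.pow_add_r 2 (Z.of_nat j)) by lia.
    set (P := (2 ^ Z.of_nat j)%Z).
    exists (c + P * (2 * c + 1) * (2 * c + 1))%Z; ring.
Qed.

(* For odd s the terms b and b + k/2 cancel since 5^(k/2) = 1 + 2^(m-1) (mod 2^m);
   for even s the sum is twice the one for s/2 at level m - 1. *)
Lemma sum_cos_pow5 (j : nat) (s : Z) :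
  (s mod 2 ^ Z.of_nat j <> 0)%Z ->
  rsum (2 ^ j) (fun b => cos (2 * PI * IZR s * IZR (5 ^ Z.of_nat b) /
                              IZR (2 ^ (Z.of_nat j + 2)))) = 0.
Proof.
  revert s; induction j as [|j IH]; intros s Hs.
  - now rewrite Z.mod_1_r in Hs.
  - destruct (pow5_pow2 j) as [c Hc].
    replace (2 ^ S j)%nat with (2 ^ j + 2 ^ j)%nat by (simpl; lia).
    rewrite rsum_add.
    replace (Z.of_nat (S j) + 2)%Z with (Z.succ (Z.of_nat j + 2)) by lia.
    rewrite Z.pow_succ_r by lia.
    set (M := (2 ^ (Z.of_nat j + 2))%Z) in *.
    assert (HM : (0 < M)%Z) by (apply Z.pow_pos_nonneg; lia); clearbody M.
    apply IZR_lt in HM.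
    assert (Hshift : forall b : nat,
      (5 ^ Z.of_nat (2 ^ j + b) = 5 ^ Z.of_nat b * (1 + M * (2 * c + 1)))%Z).
    { intros b; rewrite Nat2Z.inj_add, Z.pow_add_r, Hc by lia; ring. }
    destruct (Z.Even_or_Odd s) as [[u ->]|[u ->]].
    + assert (Hu : (u mod 2 ^ Z.of_nat j <> 0)%Z).
      { intros E; apply Hs.
        rewrite Nat2Z.inj_succ, Z.pow_succ_r, Zmult_mod_distr_l, E by lia; ring. }
      replace 0 with (0 + 0) by ring; f_equal; (etransitivity; [|exact (IH u Hu)]).
      * apply rsum_ext; intros b _; f_equal; rewrite !mult_IZR; field; lra.
      * apply rsum_ext; intros b _; rewrite Hshift; symmetry.
        rewrite <- (cos_period_Z _ (u * 5 ^ Z.of_nat b * (2 * c + 1))); f_equal.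
        repeat rewrite ?mult_IZR, ?plus_IZR; field; lra.
    + rewrite <- rsum_plus; apply rsum_0; intros b _.
      destruct (pow5_odd b) as [d Hd]; rewrite Hshift, Hd.
      (* Chosen so that 2q + 1 = (2u + 1)(2d + 1)(2c + 1): the two angles differ by this odd
         multiple of pi. *)
      set (q := (2 * u * d * (2 * c + 1) + 2 * u * c + u + d * (2 * c + 1) + c)%Z).
      match goal with |- cos ?x + cos ?y = 0 =>
        replace y with (x + (2 * IZR q + 1) * PI); [rewrite cos_odd_PI; ring|] end.
      unfold q.
      repeat rewrite ?mult_IZR, ?plus_IZR; field; lra.
Qed.

(** * The trace form of L weighted by beta *)

Lemma sin_mul_sin (x y : R) : sin x * sin y = (cos (x - y) - cos (x + y)) / 2.
Proof. rewrite cos_minus, cos_plus; field. Qed.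

(** The Dirichlet kernel 1 + 2 cos(2t) + ... + 2 cos(2it), multiplied by sin(t) so as to avoid
    division. The induction step is sin((c+1)t) - sin((c-1)t) = 2 cos(ct) sin(t) with c = 2(i+1). *)
Lemma tau_w_sin (m i b : nat) :
  let t := PI * INR (5 ^ b) / INR (2 ^ m) in
  tau_w m i b * sin t = sin (INR (2 * i + 1) * t).
Proof.
  intros t; unfold tau_w; induction i as [|i IH].
  - unfold rsum; simpl; ring_simplify (1 * t); ring.
  - rewrite rsum_S, <- Rplus_assoc, Rmult_plus_distr_r, IH.
    unfold tau_theta.
    replace (2 * PI * INR (i + 1) * INR (5 ^ b) / INR (2 ^ m)) with (INR (2 * (i + 1)) * t).
    + replace (INR (2 * S i + 1)) with (INR (2 * (i + 1)) + 1)
        by (replace (2 * S i + 1)%nat with (S (2 * (i + 1))) by lia; now rewrite S_INR).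
      replace (INR (2 * i + 1)) with (INR (2 * (i + 1)) - 1)
        by (replace (2 * (i + 1))%nat with (S (2 * i + 1)) by lia; rewrite S_INR; ring).
      set (c := INR (2 * (i + 1))).
      rewrite Rmult_minus_distr_r, Rmult_plus_distr_r, Rmult_1_l.
      rewrite sin_minus, sin_plus; ring.
    + rewrite mult_INR; unfold t; simpl (INR 2); unfold Rdiv; ring.
Qed.

Lemma tau_beta_sin (p m b : nat) : (0 < p)%nat ->
  let t := PI * INR (5 ^ b) / INR (2 ^ m) in
  tau_beta p m b = 2 * / INR (kk m) * / INR p ^ 2 * (sin t * sin t).
Proof.
  intros Hp t; unfold tau_beta, tau_theta.
  replace (2 * PI * INR 1 * INR (5 ^ b) / INR (2 ^ m)) with (2 * t)
    by (unfold t; simpl (INR 1); unfold Rdiv; ring).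
  rewrite cos_2a_sin.
  assert (0 < INR (kk m)) by (apply lt_0_INR, Nat.neq_0_lt_0, Nat.pow_nonzero; lia).
  assert (0 < INR p) by now apply lt_0_INR.
  field; split; lra.
Qed.

(** Each of the two factors sin(t) in [tau_beta] is absorbed by one of the w's. The product of sines
    then splits into cosines, leaving the cosine sums [T] at i - j and at i + j + 1. *)
Lemma tau_w_orthogonal (p m i j : nat) :
  (0 < p)%nat -> (3 <= m)%nat -> (i < kk m)%nat -> (j < kk m)%nat ->
  rsum (kk m) (fun b => tau_beta p m b * (tau_w m i b * tau_w m j b)) =
  if Nat.eqb i j then / INR p ^ 2 else 0.
Proof.
  intros Hp Hm Hi Hj.
  assert (Hk : 0 < INR (kk m)) by (apply lt_0_INR; lia).
  assert (Hp' : 0 < INR p) by now apply lt_0_INR.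
  assert (Hm2 : INR (2 ^ m) = IZR (2 ^ (Z.of_nat (m - 2) + 2))).
  { rewrite INR_IZR_INZ, Nat2Z.inj_pow; do 2 f_equal; lia. }
  assert (HkZ : Z.of_nat (kk m) = (2 ^ Z.of_nat (m - 2))%Z).
  { unfold kk; now rewrite Nat2Z.inj_pow. }
  assert (Hm0 : 0 < IZR (2 ^ (Z.of_nat (m - 2) + 2))).
  { apply IZR_lt, Z.pow_pos_nonneg; lia. }
  set (T := fun s : Z => rsum (kk m) (fun b => cos (2 * PI * IZR s * IZR (5 ^ Z.of_nat b) /
                              IZR (2 ^ (Z.of_nat (m - 2) + 2))))).
  assert (Hsum : rsum (kk m) (fun b => tau_beta p m b * (tau_w m i b * tau_w m j b)) =
    / INR (kk m) * / INR p ^ 2 * (T (Z.of_nat i - Z.of_nat j)%Z +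
                                  (-1) * T (Z.of_nat i + Z.of_nat j + 1)%Z)).
  { unfold T; rewrite <- rsum_scal, <- rsum_plus, <- rsum_scal.
    apply rsum_ext; intros b _; rewrite tau_beta_sin by assumption.
    set (t := PI * INR (5 ^ b) / INR (2 ^ m)).
    replace (2 * / INR (kk m) * / INR p ^ 2 * (sin t * sin t) * (tau_w m i b * tau_w m j b))
      with (2 * / INR (kk m) * / INR p ^ 2 * ((tau_w m i b * sin t) * (tau_w m j b * sin t)))
      by ring.
    unfold t; rewrite !tau_w_sin; fold t; rewrite sin_mul_sin.
    assert (Ht : t = PI * IZR (5 ^ Z.of_nat b) / IZR (2 ^ (Z.of_nat (m - 2) + 2))).
    { unfold t; now rewrite Hm2, INR_IZR_INZ, Nat2Z.inj_pow. }
    replace (2 * PI * IZR (Z.of_nat i - Z.of_nat j) * IZR (5 ^ Z.of_nat b) /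
      IZR (2 ^ (Z.of_nat (m - 2) + 2))) with (INR (2 * i + 1) * t - INR (2 * j + 1) * t).
    replace (2 * PI * IZR (Z.of_nat i + Z.of_nat j + 1) * IZR (5 ^ Z.of_nat b) /
      IZR (2 ^ (Z.of_nat (m - 2) + 2))) with (INR (2 * i + 1) * t + INR (2 * j + 1) * t).
    - field; split; lra.
    - rewrite Ht, !plus_IZR, <- !INR_IZR_INZ, !plus_INR, !mult_INR; simpl (INR 2); simpl (INR 1).
      field; lra.
    - rewrite Ht, !minus_IZR, <- !INR_IZR_INZ, !plus_INR, !mult_INR; simpl (INR 2); simpl (INR 1).
      field; lra. }
  rewrite Hsum.
  assert (H0 : forall s, (s mod 2 ^ Z.of_nat (m - 2) <> 0)%Z -> T s = 0).
  { intros s Hs; now apply sum_cos_pow5. }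
  (* [sum_cos_pow5] excludes multiples of k. At s = k, however, every angle is 5^b pi/2, an odd
     multiple of pi/2, so each term vanishes separately. *)
  assert (HTk : T (Z.of_nat (kk m)) = 0).
  { apply rsum_0; intros b _; apply cos_eq_0_1.
    destruct (pow5_odd b) as [d Hd]; exists d; rewrite Hd, HkZ, Z.pow_add_r by lia.
    rewrite Z.pow_add_r in Hm0 by lia.
    rewrite plus_IZR, !mult_IZR in *; change (IZR (2 ^ 2)) with 4 in *.
    field; lra. }
  (* Since 0 < i + j + 1 < 2k, the only multiple of k that can occur is k itself. *)
  assert (Hneg : T (Z.of_nat i + Z.of_nat j + 1)%Z = 0).
  { destruct (Z.eq_dec (Z.of_nat i + Z.of_nat j + 1) (Z.of_nat (kk m))) as [->|Hne];
      [exact HTk|].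
    apply H0; rewrite <- HkZ; intros E; apply Zmod_divides in E as [q Hq]; [|lia].
    assert (q = 1)%Z by nia; lia. }
  rewrite Hneg; destruct (Nat.eqb_spec i j) as [->|Hij].
  - replace (T (Z.of_nat j - Z.of_nat j)%Z) with (INR (kk m)); [field; lra|].
    unfold T; rewrite (rsum_ext _ _ (fun _ => 1)); [rewrite rsum_const; ring|].
    intros b _; rewrite Z.sub_diag, <- cos_0; f_equal; field; lra.
  (* Here 0 < |i - j| < k, so k does not divide i - j. *)
  - rewrite H0; [ring|].
    rewrite <- HkZ; intros E; apply Zmod_divides in E as [q Hq]; [|lia].
    assert (q = 0)%Z by nia; lia.
Qed.

(** * Primitive roots and p-th roots of unity *)

Lemma eqmod_divide (n a b : Z) : (0 < n)%Z ->
  (a mod n = b mod n <-> (n | a - b))%Z.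
Proof.
  intros Hn; split; intros H.
  - apply Zmod_divide; [lia|]; rewrite Zminus_mod, H, Z.sub_diag; apply Zmod_0_l.
  - destruct H as [k Hk]; replace a with (b + k * n)%Z by lia; apply Z_mod_plus_full.
Qed.

Lemma prime_not_divide_pow (q r : Z) (n : nat) :
  prime q -> ~ (q | r)%Z -> ~ (q | r ^ Z.of_nat n)%Z.
Proof.
  intros Hq Hr; induction n as [|n IH]; intros H.
  - apply Z.divide_1_r in H; destruct Hq; lia.
  - rewrite Nat2Z.inj_succ, Z.pow_succ_r in H by lia.
    apply prime_mult in H; tauto.
Qed.

Lemma prim_root_not_divide (p : nat) (r : Z) :
  prime (Z.of_nat p) -> prim_root p r -> ~ (Z.of_nat p | r)%Z.
Proof.
  intros Hp [Hr _] H; apply Hr.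
  apply Zdivide_mod, H.
Qed.

(** The factor r^u is prime to p and can be cancelled from r^v - r^u. *)
Lemma prim_root_pow_diff (p : nat) (r : Z) (u v : nat) :
  prime (Z.of_nat p) -> prim_root p r -> (u <= v)%nat ->
  (r ^ Z.of_nat u mod Z.of_nat p = r ^ Z.of_nat v mod Z.of_nat p)%Z ->
  (r ^ Z.of_nat (v - u) mod Z.of_nat p = 1)%Z.
Proof.
  intros Hp Hr Huv H.
  assert (Hp1 : (1 < Z.of_nat p)%Z) by now destruct Hp.
  rewrite <- (Z.mod_1_l (Z.of_nat p)) by lia.
  symmetry in H; apply eqmod_divide in H; [|lia]; apply eqmod_divide; [lia|].
  replace (r ^ Z.of_nat v - r ^ Z.of_nat u)%Z
    with (r ^ Z.of_nat u * (r ^ Z.of_nat (v - u) - 1))%Z in H.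
  - apply prime_mult in H as [H|H]; [|assumption|assumption].
    exfalso; revert H; apply prime_not_divide_pow; [assumption|].
    now apply prim_root_not_divide.
  - rewrite Z.mul_sub_distr_l, <- Z.pow_add_r, <- Nat2Z.inj_add by lia.
    replace (u + (v - u))%nat with v by lia; ring.
Qed.

Lemma prim_root_pow_inj (p : nat) (r : Z) (u v : nat) :
  prime (Z.of_nat p) -> prim_root p r -> (u < p - 1)%nat -> (v < p - 1)%nat ->
  (r ^ Z.of_nat u mod Z.of_nat p = r ^ Z.of_nat v mod Z.of_nat p)%Z -> u = v.
Proof.
  intros Hp Hr.
  assert (Hwlog : forall a b, (a < b)%nat -> (b < p - 1)%nat ->
    (r ^ Z.of_nat a mod Z.of_nat p <> r ^ Z.of_nat b mod Z.of_nat p)%Z).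
  { intros a b Hab Hb H; apply prim_root_pow_diff in H; [|assumption|assumption|lia].
    destruct Hr as [_ Hr]; apply (Hr (b - a)%nat); [lia|assumption]. }
  intros Hu Hv H; destruct (Nat.lt_trichotomy u v) as [Huv|[Huv|Huv]]; auto.
  - now apply Hwlog in H.
  - symmetry in H; now apply Hwlog in H.
Qed.

(** The p - 1 powers are distinct nonzero residues, and a duplicate-free list contained in another
    of the same length is a permutation of it. *)
Lemma prim_root_permutation (p : nat) (r : Z) :
  prime (Z.of_nat p) -> prim_root p r ->
  Permutation (map (fun u => (r ^ Z.of_nat u mod Z.of_nat p)%Z) (seq 0 (p - 1)))
              (map Z.of_nat (seq 1 (p - 1))).
Proof.
  intros Hp Hr.
  assert (Hp1 : (1 < Z.of_nat p)%Z) by now destruct Hp.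
  apply NoDup_Permutation_bis.
  - apply FinFun.Injective_map_NoDup_in; [|apply seq_NoDup].
    intros u v Hu Hv; apply in_seq in Hu, Hv.
    apply prim_root_pow_inj; auto; lia.
  - now rewrite !length_map, !length_seq.
  - intros x Hx; apply in_map_iff in Hx as [u [<- _]].
    set (y := (r ^ Z.of_nat u mod Z.of_nat p)%Z).
    assert (Hy : (0 <= y < Z.of_nat p)%Z) by (apply Z.mod_pos_bound; lia).
    assert (Hy0 : y <> 0%Z).
    { intros E; apply (prime_not_divide_pow (Z.of_nat p) r u); auto.
      - now apply prim_root_not_divide.
      - apply Zmod_divide; [lia|exact E]. }
    apply in_map_iff; exists (Z.to_nat y); split; [lia|apply in_seq; lia].
Qed.

(** [prim_root] only says that no smaller positive exponent gives 1. As the powers below p - 1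
    exhaust the nonzero residues, r^(p-1) equals some r^v with v < p - 1; then r^(p-1-v) = 1 forces
    v = 0. *)
Lemma prim_root_fermat (p : nat) (r : Z) :
  prime (Z.of_nat p) -> prim_root p r ->
  (r ^ Z.of_nat (p - 1) mod Z.of_nat p = 1)%Z.
Proof.
  intros Hp Hr.
  assert (Hp1 : (1 < Z.of_nat p)%Z) by now destruct Hp.
  set (y := (r ^ Z.of_nat (p - 1) mod Z.of_nat p)%Z).
  assert (Hy : (0 <= y < Z.of_nat p)%Z) by (apply Z.mod_pos_bound; lia).
  assert (Hy0 : y <> 0%Z).
  { intros E; apply (prime_not_divide_pow (Z.of_nat p) r (p - 1)); auto.
    - now apply prim_root_not_divide.
    - apply Zmod_divide; [lia|exact E]. }
  assert (Hin : In y (map (fun u => (r ^ Z.of_nat u mod Z.of_nat p)%Z) (seq 0 (p - 1)))).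
  { apply (Permutation_in _ (Permutation_sym (prim_root_permutation p r Hp Hr))).
    apply in_map_iff; exists (Z.to_nat y); split; [lia|apply in_seq; lia]. }
  apply in_map_iff in Hin as [v [Hv Hv']]; apply in_seq in Hv'.
  apply prim_root_pow_diff in Hv; [|assumption|assumption|lia].
  destruct (Nat.eq_dec v 0) as [->|Hv0]; [now rewrite Nat.sub_0_r in Hv|].
  exfalso; destruct Hr as [_ Hr]; apply (Hr (p - 1 - v)%nat); [lia|assumption].
Qed.

Lemma prim_root_period (p : nat) (r : Z) (u c : nat) :
  prime (Z.of_nat p) -> prim_root p r ->
  (r ^ Z.of_nat (u + c * (p - 1)) mod Z.of_nat p = r ^ Z.of_nat u mod Z.of_nat p)%Z.
Proof.
  intros Hp Hr; induction c as [|c IH]; [now rewrite Nat.add_0_r|].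
  replace (u + S c * (p - 1))%nat with (u + c * (p - 1) + (p - 1))%nat by lia.
  rewrite Nat2Z.inj_add, Z.pow_add_r by apply Nat2Z.is_nonneg.
  rewrite Zmult_mod, prim_root_fermat, IH, Z.mul_1_r by assumption.
  apply Zmod_mod.
Qed.

Lemma prim_root_pow_eq (p : nat) (r : Z) (a b : nat) :
  prime (Z.of_nat p) -> prim_root p r ->
  (r ^ Z.of_nat a mod Z.of_nat p = r ^ Z.of_nat b mod Z.of_nat p)%Z ->
  (a mod (p - 1) = b mod (p - 1))%nat.
Proof.
  intros Hp Hr H.
  assert (Hp1 : (1 < Z.of_nat p)%Z) by now destruct Hp.
  assert (Hred : forall x, (r ^ Z.of_nat x mod Z.of_nat p =
                            r ^ Z.of_nat (x mod (p - 1)) mod Z.of_nat p)%Z).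
  { intros x; rewrite <- (prim_root_period p r (x mod (p - 1)) (x / (p - 1))) by assumption.
    do 3 f_equal; rewrite Nat.add_comm, Nat.mul_comm; apply Nat.div_mod; lia. }
  rewrite Hred, (Hred b) in H.
  apply prim_root_pow_inj in H; auto; apply Nat.mod_upper_bound; lia.
Qed.

(** The square of r^h is 1 modulo p, so r^h is 1 or -1, and 1 is excluded because 0 < h < p - 1. *)
Lemma prim_root_half (p h : nat) (r : Z) :
  prime (Z.of_nat p) -> prim_root p r -> (p = 2 * h + 1)%nat ->
  (Z.of_nat p | r ^ Z.of_nat h + 1)%Z.
Proof.
  intros Hp Hr Hh.
  assert (Hp1 : (1 < Z.of_nat p)%Z) by now destruct Hp.
  pose proof (prim_root_fermat p r Hp Hr) as H.
  rewrite <- (Z.mod_1_l (Z.of_nat p)) in H by lia.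
  apply eqmod_divide in H; [|lia].
  replace (p - 1)%nat with (h + h)%nat in H by lia.
  rewrite Nat2Z.inj_add, Z.pow_add_r in H by lia.
  set (y := (r ^ Z.of_nat h)%Z) in *.
  replace (y * y - 1)%Z with ((y - 1) * (y + 1))%Z in H by ring.
  apply prime_mult in H as [H|H]; [|assumption|assumption].
  apply eqmod_divide in H; [|lia].
  rewrite Z.mod_1_l in H by lia.
  exfalso; destruct Hr as [_ Hr]; apply (Hr h); [lia|exact H].
Qed.

(** * Complex numbers as pairs of reals *)

Definition Copp (u : Cx) : Cx := (- fst u, - snd u).
Definition Cconj (u : Cx) : Cx := (fst u, - snd u).
Definition Cnorm2 (u : Cx) : R := fst u * fst u + snd u * snd u.

Lemma Cx_ring : ring_theory C0 C1 Cadd Cmul Csub Copp eq.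
Proof.
  constructor; intros; repeat match goal with u : Cx |- _ => destruct u end;
    unfold C0, C1, Cadd, Cmul, Csub, Copp; simpl; f_equal; ring.
Qed.
Add Ring Cx_ring : Cx_ring.

Lemma Cmul_conj (u : Cx) : Cmul u (Cconj u) = (Cnorm2 u, 0).
Proof. unfold Cmul, Cconj, Cnorm2; simpl; f_equal; ring. Qed.

Lemma Cconj_mul (u v : Cx) : Cconj (Cmul u v) = Cmul (Cconj u) (Cconj v).
Proof. unfold Cmul, Cconj; simpl; f_equal; ring. Qed.

Lemma Cnorm2_mul (u v : Cx) : Cnorm2 (Cmul u v) = Cnorm2 u * Cnorm2 v.
Proof. unfold Cmul, Cnorm2; simpl; ring. Qed.

(** The squared norm is multiplicative and vanishes only at 0, so the absence of zero divisors
    carries over from the reals. *)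
Lemma Cmul_integral (u v : Cx) : Cmul u v = C0 -> u <> C0 -> v = C0.
Proof.
  intros H Hu.
  assert (Hn : Cnorm2 u * Cnorm2 v = 0).
  { rewrite <- Cnorm2_mul, H; unfold Cnorm2, C0; simpl; ring. }
  assert (Hz : forall w, Cnorm2 w = 0 -> w = C0).
  { intros [x y] Hw; unfold Cnorm2 in Hw; simpl in Hw; unfold C0; f_equal; nra. }
  apply Rmult_integral in Hn as [Hn|Hn]; auto.
  now apply Hz in Hn.
Qed.

Lemma Cmul_cancel_l (u v w : Cx) : u <> C0 -> Cmul u v = Cmul u w -> v = w.
Proof.
  intros Hu H.
  assert (E : Csub v w = C0).
  { apply (Cmul_integral u); [|assumption].
    replace (Cmul u (Csub v w)) with (Csub (Cmul u v) (Cmul u w)) by ring.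
    rewrite H; ring. }
  replace v with (Cadd (Csub v w) w) by ring; rewrite E; ring.
Qed.

Lemma Csum_S (n : nat) (f : nat -> Cx) : Csum (S n) f = Cadd (Csum n f) (f n).
Proof. apply fold_right_seq_S; intros; ring. Qed.

Lemma Cprod_S (n : nat) (f : nat -> Cx) : Cprod (S n) f = Cmul (Cprod n f) (f n).
Proof. apply fold_right_seq_S; intros; ring. Qed.

Lemma Csum_eq_rsum (n : nat) (f : nat -> Cx) :
  Csum n f = (rsum n (fun j => fst (f j)), rsum n (fun j => snd (f j))).
Proof.
  induction n as [|n IH]; [reflexivity|now rewrite Csum_S, IH, !rsum_S].
Qed.

Lemma Csum_ext (n : nat) (f g : nat -> Cx) :
  (forall i, (i < n)%nat -> f i = g i) -> Csum n f = Csum n g.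
Proof.
  induction n as [|n IH]; intros H; [reflexivity|].
  rewrite !Csum_S, IH, H; auto.
Qed.

Lemma Cprod_ext (n : nat) (f g : nat -> Cx) :
  (forall i, (i < n)%nat -> f i = g i) -> Cprod n f = Cprod n g.
Proof.
  induction n as [|n IH]; intros H; [reflexivity|].
  rewrite !Cprod_S, IH, H; auto.
Qed.

Lemma Csum_scal (n : nat) (c : Cx) (f : nat -> Cx) :
  Csum n (fun j => Cmul c (f j)) = Cmul c (Csum n f).
Proof.
  induction n as [|n IH]; [unfold Csum; simpl; ring|].
  rewrite !Csum_S, IH; ring.
Qed.

Lemma Cprod_add (a b : nat) (f : nat -> Cx) :
  Cprod (a + b) f = Cmul (Cprod a f) (Cprod b (fun j => f (a + j)%nat)).
Proof.
  induction b as [|b IH].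
  - rewrite Nat.add_0_r; unfold Cprod at 3; simpl; ring.
  - rewrite Nat.add_succ_r, !Cprod_S, IH; ring.
Qed.

Lemma Cprod_conj (n : nat) (f : nat -> Cx) :
  Cconj (Cprod n f) = Cprod n (fun j => Cconj (f j)).
Proof.
  induction n as [|n IH].
  - unfold Cprod, Cconj, C1; simpl; f_equal; ring.
  - now rewrite !Cprod_S, Cconj_mul, IH.
Qed.

(** * Powers of zeta_p and their sums and products *)

Lemma zeta_pow_add (p : nat) (a b : Z) :
  zeta_pow p (a + b) = Cmul (zeta_pow p a) (zeta_pow p b).
Proof.
  unfold zeta_pow, Cmul; simpl.
  replace (2 * PI * IZR (a + b) / INR p)
    with (2 * PI * IZR a / INR p + 2 * PI * IZR b / INR p)
    by (rewrite plus_IZR; unfold Rdiv; ring).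
  rewrite cos_plus, sin_plus; f_equal; ring.
Qed.

Lemma zeta_pow_0 (p : nat) : zeta_pow p 0 = C1.
Proof.
  unfold zeta_pow, C1; replace (2 * PI * 0 / INR p) with 0 by (unfold Rdiv; ring).
  now rewrite cos_0, sin_0.
Qed.

Lemma zeta_pow_divide (p : nat) (a : Z) :
  (0 < p)%nat -> (Z.of_nat p | a)%Z -> zeta_pow p a = C1.
Proof.
  intros Hp [k ->]; rewrite <- (zeta_pow_0 p); unfold zeta_pow.
  replace (2 * PI * IZR (k * Z.of_nat p) / INR p) with (2 * PI * 0 / INR p + 2 * IZR k * PI).
  - now rewrite cos_period_Z, sin_period_Z.
  - rewrite mult_IZR, <- INR_IZR_INZ; field.
    apply not_0_INR; lia.
Qed.

Lemma zeta_pow_eqmod (p : nat) (a b : Z) :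
  (0 < p)%nat -> (a mod Z.of_nat p = b mod Z.of_nat p)%Z -> zeta_pow p a = zeta_pow p b.
Proof.
  intros Hp H; apply eqmod_divide in H; [|lia].
  replace a with (b + (a - b))%Z by ring.
  rewrite zeta_pow_add, (zeta_pow_divide p (a - b)) by assumption; ring.
Qed.

Lemma zeta_pow_opp (p : nat) (a : Z) : zeta_pow p (- a) = Cconj (zeta_pow p a).
Proof.
  unfold zeta_pow, Cconj; simpl.
  replace (2 * PI * IZR (- a) / INR p) with (- (2 * PI * IZR a / INR p))
    by (rewrite opp_IZR; unfold Rdiv; ring).
  now rewrite cos_neg, sin_neg.
Qed.

Lemma Cnorm2_zeta_pow (p : nat) (a : Z) : Cnorm2 (zeta_pow p a) = 1.
Proof. unfold Cnorm2; rewrite Rplus_comm; apply sin2_cos2. Qed.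

(** After reduction of the exponent to 0 <= b < p, the real part is 1 - 2 sin(pi b/p)^2, and this
    sine is positive unless b = 0. *)
Lemma zeta_pow_eq_1 (p : nat) (a : Z) :
  (0 < p)%nat -> zeta_pow p a = C1 -> (Z.of_nat p | a)%Z.
Proof.
  intros Hp H; apply Zmod_divide; [lia|].
  rewrite (zeta_pow_eqmod p a (a mod Z.of_nat p)) in H by (auto; now rewrite Zmod_mod).
  assert (Hb : (0 <= a mod Z.of_nat p < Z.of_nat p)%Z) by (apply Z.mod_pos_bound; lia).
  set (b := (a mod Z.of_nat p)%Z) in *.
  destruct (Z.eq_dec b 0) as [E|E]; [exact E|exfalso].
  apply (f_equal fst) in H; unfold zeta_pow, C1 in H; simpl in H.
  set (x := PI * IZR b / INR p) in *.
  replace (2 * PI * IZR b / INR p) with (2 * x) in H by (unfold x, Rdiv; ring).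
  rewrite cos_2a_sin in H.
  assert (Hb0 : 0 < IZR b) by (apply IZR_lt; lia).
  assert (Hbp : IZR b < INR p) by (rewrite INR_IZR_INZ; apply IZR_lt; lia).
  pose proof PI_RGT_0.
  assert (0 < sin x); [|nra].
  apply sin_gt_0; unfold x.
  - apply Rdiv_lt_0_compat; nra.
  - apply (Rmult_lt_reg_r (INR p)); [lra|].
    unfold Rdiv; rewrite Rmult_assoc, Rinv_l by lra; nra.
Qed.

(** Multiplication by 1 - zeta^c, which is nonzero, telescopes the sum to 1 - zeta^(pc) = 0. *)
Lemma zeta_pow_geometric (p : nat) (c : Z) : (0 < p)%nat -> ~ (Z.of_nat p | c)%Z ->
  Csum p (fun k => zeta_pow p (Z.of_nat k * c)) = C0.
Proof.
  intros Hp Hc.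
  assert (Hgeom : forall n, Cmul (Csub C1 (zeta_pow p c))
    (Csum n (fun k => zeta_pow p (Z.of_nat k * c))) = Csub C1 (zeta_pow p (Z.of_nat n * c))).
  { induction n as [|n IH].
    - simpl (Z.of_nat 0 * c)%Z; rewrite zeta_pow_0; unfold Csum; simpl; ring.
    - rewrite Csum_S.
      replace (Z.of_nat (S n) * c)%Z with (c + Z.of_nat n * c)%Z by lia.
      rewrite zeta_pow_add.
      transitivity (Cadd (Csub C1 (zeta_pow p (Z.of_nat n * c)))
        (Cmul (Csub C1 (zeta_pow p c)) (zeta_pow p (Z.of_nat n * c)))); [|ring].
      rewrite <- IH; ring. }
  specialize (Hgeom p).
  rewrite (zeta_pow_divide p (Z.of_nat p * c)) in Hgeom by (auto; exists c; ring).
  apply (Cmul_integral (Csub C1 (zeta_pow p c))).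
  - rewrite Hgeom; ring.
  - intros E; apply Hc, zeta_pow_eq_1; auto.
    replace (zeta_pow p c) with (Csub C1 (Csub C1 (zeta_pow p c))) by ring.
    rewrite E; ring.
Qed.

Lemma rsum_prim_root (p : nat) (r : Z) (g : Z -> R) :
  prime (Z.of_nat p) -> prim_root p r ->
  (forall a b, (a mod Z.of_nat p = b mod Z.of_nat p)%Z -> g a = g b) ->
  rsum (p - 1) (fun u => g (r ^ Z.of_nat u)%Z) = rsum (p - 1) (fun k => g (Z.of_nat (S k))).
Proof.
  intros Hp Hr Hg.
  rewrite (rsum_ext _ _ (fun u => g (r ^ Z.of_nat u mod Z.of_nat p)%Z)).
  - unfold rsum.
    rewrite <- (map_map (fun u => (r ^ Z.of_nat u mod Z.of_nat p)%Z) g).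
    rewrite <- (map_map S (fun k => g (Z.of_nat k))), seq_shift.
    rewrite <- (map_map Z.of_nat g).
    pose proof (Permutation_map g (prim_root_permutation p r Hp Hr)) as H.
    (* A sum does not depend on the order of its terms: induction on the permutation. *)
    induction H; simpl; lra.
  - intros u _; apply Hg; now rewrite Zmod_mod.
Qed.

(** The exponents r^u run over all nonzero residues. If p divides c every term is 1; otherwise the
    sum is a full geometric sum without its term at residue 0. *)
Lemma sum_cos_prim_root (p : nat) (r c : Z) :
  prime (Z.of_nat p) -> prim_root p r ->
  rsum (p - 1) (fun u => fst (zeta_pow p (r ^ Z.of_nat u * c))) =
  if Z.eqb (c mod Z.of_nat p) 0 then INR p - 1 else - 1.
Proof.
  intros Hp Hr.
  assert (Hp1 : (1 < Z.of_nat p)%Z) by now destruct Hp.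
  destruct (Z.eqb_spec (c mod Z.of_nat p) 0) as [Hc|Hc].
  - rewrite (rsum_ext _ _ (fun _ => 1)).
    + rewrite rsum_const, minus_INR by lia; simpl (INR 1); ring.
    + intros u _; rewrite zeta_pow_divide; [reflexivity|lia|].
      apply Z.divide_mul_r, Zmod_divide; [lia|assumption].
  - rewrite (rsum_prim_root p r (fun a => fst (zeta_pow p (a * c)))); auto.
    + assert (H : rsum p (fun k => fst (zeta_pow p (Z.of_nat k * c))) = 0).
      { pose proof (zeta_pow_geometric p c) as H.
        rewrite Csum_eq_rsum in H; apply (f_equal fst) in H; [exact H|lia|].
        now intros E; apply Hc, Zdivide_mod. }
      (* The term at k = 0 is 1 and the whole sum is 0, so the other p - 1 terms add up to -1. *)
      replace p with (1 + (p - 1))%nat in H at 1 by lia.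
      rewrite rsum_add, rsum_S in H; change (Z.of_nat 0 * c)%Z with 0%Z in H.
      rewrite zeta_pow_0 in H; change (rsum 0 _) with 0 in H; change (fst C1) with 1 in H.
      simpl plus in H; lra.
    + intros a b H; rewrite (zeta_pow_eqmod p (a * c) (b * c)); [reflexivity|lia|].
      now rewrite Zmult_mod, H, <- Zmult_mod.
Qed.

(* Monic polynomials, given by their list of non-leading coefficients. *)
Definition mpeval (cs : list Cx) (x : Cx) : Cx :=
  fold_right (fun c acc => Cadd c (Cmul x acc)) C1 cs.

(** Synthetic division by X - a. The constant coefficient of the quotient is the value at [a] of the
    tail [cs]; the quotient is again monic, one degree lower. *)
Lemma mpeval_division (cs : list Cx) (c a : Cx) :
  exists qs, length qs = length cs /\ forall x,
    mpeval (c :: cs) x = Cadd (mpeval (c :: cs) a) (Cmul (Csub x a) (mpeval qs x)).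
Proof.
  revert c; induction cs as [|c' cs IH]; intros c.
  - exists nil; split; [reflexivity|intros x; unfold mpeval; simpl; ring].
  - destruct (IH c') as [qs [Hlen Hqs]].
    exists (mpeval (c' :: cs) a :: qs); split; [simpl; now f_equal|intros x].
    change (mpeval (c :: c' :: cs) x) with (Cadd c (Cmul x (mpeval (c' :: cs) x))).
    change (mpeval (c :: c' :: cs) a) with (Cadd c (Cmul a (mpeval (c' :: cs) a))).
    change (mpeval (mpeval (c' :: cs) a :: qs) x)
      with (Cadd (mpeval (c' :: cs) a) (Cmul x (mpeval qs x))).
    rewrite Hqs; ring.
Qed.

(** The last root is divided out. The other roots differ from it, so they are roots of the quotient,
    to which induction applies. *)
Lemma mpeval_roots (n : nat) (cs : list Cx) (a : nat -> Cx) :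
  length cs = n ->
  (forall i j, (i < j)%nat -> (j < n)%nat -> a i <> a j) ->
  (forall i, (i < n)%nat -> mpeval cs (a i) = C0) ->
  forall x, mpeval cs x = Cprod n (fun i => Csub x (a i)).
Proof.
  revert cs; induction n as [|n IH]; intros cs Hlen Hinj Hroot x.
  - destruct cs; [reflexivity|discriminate].
  - destruct cs as [|c cs]; [discriminate|].
    destruct (mpeval_division cs c (a n)) as [qs [Hqlen Hqs]].
    rewrite (Hroot n) in Hqs by lia.
    rewrite Cprod_S, <- (IH qs), Hqs; [ring| |auto|].
    + simpl in Hlen; lia.
    + intros i Hi; apply (Cmul_integral (Csub (a i) (a n))).
      * rewrite <- (Hroot i), Hqs by lia; ring.
      * intros E; apply (Hinj i n); [lia|lia|].
        replace (a i) with (Cadd (Csub (a i) (a n)) (a n)) by ring; rewrite E; ring.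
Qed.

(** The zeta^(r^j) are the p - 1 distinct roots of 1 + X + ... + X^(p-1), encoded as
    [repeat C1 (p - 1)] because the leading coefficient is implicit. Evaluating the factorization at
    1 gives p. *)
Lemma prod_one_sub_zeta (p : nat) (r : Z) :
  prime (Z.of_nat p) -> prim_root p r ->
  Cprod (p - 1) (fun j => Csub C1 (zeta_pow p (r ^ Z.of_nat j))) = (INR p, 0).
Proof.
  intros Hp Hr.
  assert (Hp1 : (1 < Z.of_nat p)%Z) by now destruct Hp.
  rewrite <- (mpeval_roots (p - 1) (repeat C1 (p - 1))
                (fun j => zeta_pow p (r ^ Z.of_nat j))).
  - assert (H : forall n, mpeval (repeat C1 n) C1 = (INR (S n), 0)).
    { induction n as [|n IH]; [reflexivity|].
      change (mpeval (repeat C1 (S n)) C1) with (Cadd C1 (Cmul C1 (mpeval (repeat C1 n) C1))).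
      rewrite IH, (S_INR (S n)); generalize (INR (S n)); intros y; unfold Cadd, Cmul, C1; simpl fst; simpl snd; f_equal; ring. }
    rewrite H; do 2 f_equal; lia.
  - apply repeat_length.
  - intros i j Hij Hj E.
    assert (E1 : zeta_pow p (r ^ Z.of_nat i - r ^ Z.of_nat j) = C1).
    { unfold Z.sub; rewrite zeta_pow_add, E, <- zeta_pow_add, Z.add_opp_diag_r.
      apply zeta_pow_0. }
    apply zeta_pow_eq_1, eqmod_divide in E1; [|lia|lia].
    apply prim_root_pow_inj in E1; auto; lia.
  - intros i Hi.
    set (c := (r ^ Z.of_nat i)%Z).
    assert (Hc : ~ (Z.of_nat p | c)%Z).
    { apply prime_not_divide_pow; [assumption|now apply prim_root_not_divide]. }
    (* The identity (1 - X)(1 + ... + X^n) = 1 - X^(n+1) at X = zeta^c. *)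
    assert (H : forall n, Cmul (Csub C1 (zeta_pow p c)) (mpeval (repeat C1 n) (zeta_pow p c)) =
                          Csub C1 (zeta_pow p (Z.of_nat (S n) * c))).
    { induction n as [|n IH].
      - rewrite Z.mul_1_l; unfold mpeval; simpl; ring.
      - change (mpeval (repeat C1 (S n)) (zeta_pow p c))
          with (Cadd C1 (Cmul (zeta_pow p c) (mpeval (repeat C1 n) (zeta_pow p c)))).
        replace (Z.of_nat (S (S n)) * c)%Z with (c + Z.of_nat (S n) * c)%Z by lia.
        rewrite zeta_pow_add.
        transitivity (Cadd (Csub C1 (zeta_pow p c)) (Cmul (zeta_pow p c)
          (Csub C1 (zeta_pow p (Z.of_nat (S n) * c))))); [|ring].
        rewrite <- IH; ring. }
    apply (Cmul_integral (Csub C1 (zeta_pow p c))).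
    + rewrite H, (zeta_pow_divide p); [ring|lia|].
      replace (S (p - 1)) with p by lia; exists c; ring.
    + intros E; apply Hc, zeta_pow_eq_1; [lia|].
      replace (zeta_pow p c) with (Csub C1 (Csub C1 (zeta_pow p c))) by ring.
      rewrite E; ring.
Qed.

(** * The trace form of K *)

(** Since r^h = -1 modulo p, the automorphism sigma^h is complex conjugation. *)
Lemma zeta_pow_half (p h : nat) (r c : Z) (s : nat) :
  prime (Z.of_nat p) -> prim_root p r -> p = (2 * h + 1)%nat ->
  zeta_pow p (c * r ^ Z.of_nat (s + h)) = Cconj (zeta_pow p (c * r ^ Z.of_nat s)).
Proof.
  intros Hp Hr Hh; rewrite <- zeta_pow_opp; apply zeta_pow_eqmod; [lia|].
  apply eqmod_divide; [lia|].
  rewrite Nat2Z.inj_add, Z.pow_add_r by lia.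
  replace (c * (r ^ Z.of_nat s * r ^ Z.of_nat h) - - (c * r ^ Z.of_nat s))%Z
    with (c * r ^ Z.of_nat s * (r ^ Z.of_nat h + 1))%Z by ring.
  now apply Z.divide_mul_r, prim_root_half.
Qed.

Lemma one_sub_zeta_half (p h : nat) (r : Z) (s : nat) :
  prime (Z.of_nat p) -> prim_root p r -> p = (2 * h + 1)%nat ->
  Csub C1 (zeta_pow p (r ^ Z.of_nat (s + h))) =
  Cconj (Csub C1 (zeta_pow p (r ^ Z.of_nat s))).
Proof.
  intros Hp Hr Hh.
  rewrite <- (Z.mul_1_l (r ^ _)), (zeta_pow_half p h), Z.mul_1_l by assumption.
  unfold Cconj, Csub, C1; simpl; f_equal; ring.
Qed.

Lemma one_sub_zeta_neq0 (p : nat) (r : Z) (s : nat) :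
  prime (Z.of_nat p) -> prim_root p r ->
  Csub C1 (zeta_pow p (r ^ Z.of_nat s)) <> C0.
Proof.
  intros Hp Hr E.
  assert (Hp1 : (1 < Z.of_nat p)%Z) by now destruct Hp.
  apply (prime_not_divide_pow (Z.of_nat p) r s); auto.
  - now apply prim_root_not_divide.
  - apply zeta_pow_eq_1; [lia|].
    set (y := zeta_pow p (r ^ Z.of_nat s)) in *.
    replace y with (Csub C1 (Csub C1 y)) by ring; rewrite E; ring.
Qed.

(* sigma^s(zeta_p^lam * alpha) *)
Definition sigma_A (p : nat) (r lam : Z) (s : nat) : Cx :=
  Cmul (zeta_pow p (lam * r ^ Z.of_nat s))
       (Cprod ((p - 3) / 2 + 1) (fun j => Csub C1 (zeta_pow p (r ^ Z.of_nat (j + s))))).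

Lemma Cprod_shift (n : nat) (f : nat -> Cx) :
  Cmul (f 0%nat) (Cprod n (fun j => f (S j))) = Cmul (Cprod n f) (f n).
Proof.
  induction n as [|n IH].
  - unfold Cprod; simpl; ring.
  - rewrite !Cprod_S.
    transitivity (Cmul (Cmul (f 0%nat) (Cprod n (fun j => f (S j)))) (f (S n))); [ring|].
    rewrite IH; ring.
Qed.

(* sigma(alpha) = - zeta_p^(-1) alpha, and lam (r - 1) = 1 (mod p) absorbs zeta_p^(-1). *)
Lemma sigma_A_S (p h : nat) (r lam : Z) (s : nat) :
  prime (Z.of_nat p) -> prim_root p r -> p = (2 * h + 1)%nat ->
  ((lam * (r - 1)) mod Z.of_nat p = 1 mod Z.of_nat p)%Z ->
  sigma_A p r lam (S s) = Copp (sigma_A p r lam s).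
Proof.
  intros Hp Hr Hh Hlam; unfold sigma_A.
  assert (Hp1 : (1 < Z.of_nat p)%Z) by now destruct Hp.
  replace ((p - 3) / 2 + 1)%nat with h by
    (replace (p - 3)%nat with ((h - 1) * 2)%nat by lia; rewrite Nat.div_mul; lia).
  set (e := (r ^ Z.of_nat s)%Z).
  assert (Hzz : Cmul (zeta_pow p e) (zeta_pow p (- e)) = C1).
  { rewrite <- zeta_pow_add, Z.add_opp_diag_r; apply zeta_pow_0. }
  assert (Hlam' : zeta_pow p (lam * r ^ Z.of_nat (S s)) =
                  Cmul (zeta_pow p e) (zeta_pow p (lam * e))).
  { rewrite <- zeta_pow_add; apply zeta_pow_eqmod; [lia|].
    apply eqmod_divide in Hlam; [|lia]; apply eqmod_divide; [lia|].
    rewrite Nat2Z.inj_succ, Z.pow_succ_r by lia; fold e.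
    replace (lam * (r * e) - (e + lam * e))%Z with (e * (lam * (r - 1) - 1))%Z by ring.
    now apply Z.divide_mul_r. }
  set (f := fun j => Csub C1 (zeta_pow p (r ^ Z.of_nat (j + s)))).
  assert (Hprod : Cprod h (fun j => Csub C1 (zeta_pow p (r ^ Z.of_nat (j + S s)))) =
                  Copp (Cmul (zeta_pow p (- e)) (Cprod h f))).
  (* Shifting the product by one replaces the factor f(0) by f(h). Multiplying both sides by f(0)
     allows the comparison without division. *)
  { apply (Cmul_cancel_l (f 0%nat)); [now apply one_sub_zeta_neq0|].
    rewrite (Cprod_ext _ _ (fun j => f (S j))) by
      (intros j _; unfold f; now rewrite Nat.add_succ_r).
    rewrite Cprod_shift.
    (* f(h) is the conjugate of f(0), and 1 - zeta^(-e) = -zeta^(-e) (1 - zeta^e). *)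
    assert (Hfh : f h = Copp (Cmul (zeta_pow p (- e)) (f 0%nat))).
    { unfold f; rewrite Nat.add_comm, (one_sub_zeta_half p h) by assumption.
      simpl (0 + s)%nat; fold e.
      transitivity (Csub C1 (zeta_pow p (- e))).
      - rewrite zeta_pow_opp; unfold Cconj, Csub, C1; simpl; f_equal; ring.
      - rewrite <- Hzz at 1; ring. }
    rewrite Hfh; ring. }
  rewrite Hlam', Hprod.
  transitivity (Copp (Cmul (Cmul (zeta_pow p e) (zeta_pow p (- e)))
                           (Cmul (zeta_pow p (lam * e)) (Cprod h f)))); [ring|].
  rewrite Hzz; ring.
Qed.

Lemma sigma_A_sign (p h : nat) (r lam : Z) (s : nat) :
  prime (Z.of_nat p) -> prim_root p r -> p = (2 * h + 1)%nat ->
  ((lam * (r - 1)) mod Z.of_nat p = 1 mod Z.of_nat p)%Z ->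
  sigma_A p r lam s = Cmul (sigma_A p r lam 0) ((-1) ^ s, 0).
Proof.
  intros Hp Hr Hh Hlam; induction s as [|s IH].
  - change ((-1) ^ 0, 0) with C1; ring.
  - rewrite (sigma_A_S p h), IH by assumption.
    replace ((-1) ^ S s, 0) with (Copp ((-1) ^ s, 0)); [ring|].
    unfold Copp; simpl; f_equal; ring.
Qed.

(** The product alpha has the first h factors of the full product of the 1 - zeta^(r^j), and its
    conjugate supplies the remaining h; the full product is p. *)
Lemma Cnorm2_sigma_A (p h : nat) (r lam : Z) :
  prime (Z.of_nat p) -> prim_root p r -> p = (2 * h + 1)%nat ->
  Cnorm2 (sigma_A p r lam 0) = INR p.
Proof.
  intros Hp Hr Hh; unfold sigma_A.
  assert (Hp1 : (1 < Z.of_nat p)%Z) by now destruct Hp.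
  rewrite Cnorm2_mul, Cnorm2_zeta_pow, Rmult_1_l.
  replace ((p - 3) / 2 + 1)%nat with h by
    (replace (p - 3)%nat with ((h - 1) * 2)%nat by lia; rewrite Nat.div_mul; lia).
  set (u := Cprod h _).
  assert (H : Cmul u (Cconj u) = (INR p, 0)).
  { rewrite <- (prod_one_sub_zeta p r) by assumption.
    replace (p - 1)%nat with (h + h)%nat by lia.
    rewrite Cprod_add; f_equal; unfold u.
    - apply Cprod_ext; intros j _; now rewrite Nat.add_0_r.
    - rewrite Cprod_conj; apply Cprod_ext; intros j _.
      now rewrite Nat.add_0_r, (Nat.add_comm h), (one_sub_zeta_half p h). }
  rewrite Cmul_conj in H; now inversion H.
Qed.

Lemma sigma_z_half (p h : nat) (r lam : Z) (s : nat) :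
  prime (Z.of_nat p) -> prim_root p r -> p = (2 * h + 1)%nat ->
  sigma_z p r lam (s + h) = Cconj (sigma_z p r lam s).
Proof.
  intros Hp Hr Hh; unfold sigma_z.
  rewrite !Cconj_mul, (zeta_pow_half p h), (one_sub_zeta_half p h), Cprod_conj by assumption.
  do 2 f_equal; apply Cprod_ext; intros j _.
  now rewrite Nat.add_assoc, (one_sub_zeta_half p h).
Qed.

(** * Sums over exponents in a class modulo l, and their correlations *)

Definition trace_sum (q l : nat) (g : nat -> R) (t : nat) : R :=
  rsum q (fun j => g (t + (j + 1) * l)%nat).

(** Moving t by l permutes the q terms cyclically, since g has period ql. *)
Lemma trace_sum_periodic (q l : nat) (g : nat -> R) (t c : nat) :
  (forall u, g (u + q * l)%nat = g u) ->
  trace_sum q l g (t + c * l) = trace_sum q l g t.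
Proof.
  intros Hg; induction c as [|c IH]; [now rewrite Nat.add_0_r|].
  rewrite <- IH; unfold trace_sum.
  rewrite <- (rsum_shift q (fun j => g (t + c * l + (j + 1) * l)%nat)).
  - apply rsum_ext; intros j _; f_equal; ring.
  - rewrite <- (Hg (t + c * l + (0 + 1) * l)%nat); f_equal; ring.
Qed.

(** The sum over a and the terms of the first factor merge into one sum over u = j l + a, which runs
    through a whole period; the second factor is unchanged when a is replaced by u. *)
Lemma trace_sum_correlation (q l : nat) (g g' : nat -> R) (i i' : nat) :
  (forall u, g' (u + q * l)%nat = g' u) ->
  rsum l (fun a => trace_sum q l g (a + i) * trace_sum q l g' (a + i')) =
  rsum q (fun j => rsum (q * l) (fun u => g (u + i + l)%nat * g' (u + i' + (j + 1) * l)%nat)).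
Proof.
  intros Hg'.
  transitivity (rsum (q * l) (fun u => g (u + i + l)%nat * trace_sum q l g' (u + i'))).
  - rewrite rsum_mul, rsum_exchange; apply rsum_ext; intros a _.
    unfold trace_sum at 1; rewrite <- rsum_scal_r; apply rsum_ext; intros j _.
    replace (j * l + a + i')%nat with (a + i' + j * l)%nat by ring.
    rewrite trace_sum_periodic by assumption; do 2 f_equal; ring.
  - rewrite rsum_exchange; apply rsum_ext; intros u _.
    unfold trace_sum; now rewrite <- rsum_scal.
Qed.

Lemma pow_m1_mul_odd (a l : nat) : Nat.Odd l -> (-1) ^ (a * l) = (-1) ^ a.
Proof.
  intros [k ->]; replace (a * (2 * k + 1))%nat with (2 * (a * k) + a)%nat by ring.
  rewrite pow_add, pow_1_even; ring.
Qed.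

Definition signed_re (p : nat) (r : Z) (u : nat) : R :=
  (-1) ^ u * fst (zeta_pow p (r ^ Z.of_nat u)).
Definition signed_im (p : nat) (r : Z) (u : nat) : R :=
  (-1) ^ u * snd (zeta_pow p (r ^ Z.of_nat u)).

(** The left side is the real part of one signed power of zeta times the conjugate of the other; the
    common sign (-1)^u squares to 1. *)
Lemma signed_mul (p : nat) (r : Z) (u a b : nat) :
  signed_re p r (u + a) * signed_re p r (u + b) +
  signed_im p r (u + a) * signed_im p r (u + b) =
  (-1) ^ (a + b) *
  fst (zeta_pow p (r ^ Z.of_nat u * (r ^ Z.of_nat a - r ^ Z.of_nat b))).
Proof.
  replace (r ^ Z.of_nat u * (r ^ Z.of_nat a - r ^ Z.of_nat b))%Z
    with (r ^ Z.of_nat (u + a) + - (r ^ Z.of_nat (u + b)))%Z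
    by (rewrite !Nat2Z.inj_add, !Z.pow_add_r by lia; ring).
  rewrite zeta_pow_add, zeta_pow_opp; unfold signed_re, signed_im, Cmul, Cconj; simpl.
  rewrite !pow_add.
  assert (Hu : (-1) ^ u * (-1) ^ u = 1).
  { rewrite <- pow_add; replace (u + u)%nat with (2 * u)%nat by lia; apply pow_1_even. }
  set (x := (-1) ^ u) in *.
  match goal with |- ?L = ?T => replace L with ((x * x) * T) by ring end.
  rewrite Hu; ring.
Qed.

Lemma signed_periodic (p c : nat) (r : Z) (u : nat) :
  prime (Z.of_nat p) -> prim_root p r -> p = (2 * c + 1)%nat ->
  signed_re p r (u + (p - 1)) = signed_re p r u /\
  signed_im p r (u + (p - 1)) = signed_im p r u.
Proof.
  intros Hp Hr Hc; unfold signed_re, signed_im.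
  rewrite (zeta_pow_eqmod p _ (r ^ Z.of_nat u)).
  - rewrite pow_add; replace (p - 1)%nat with (2 * c)%nat by lia.
    rewrite pow_1_even; split; ring.
  - lia.
  - rewrite <- (prim_root_period p r u 1) by assumption; do 3 f_equal; lia.
Qed.

(** Each inner sum over u is p - 1 or -1, up to the sign (-1)^(i+i'+j). Writing p - 1 as p + (-1),
    the terms -1 cancel because j alternates over an even range, and p survives only for i = i' and
    j = 0. *)
Lemma signed_trace_orthogonal (p l c : nat) (r : Z) (i i' : nat) :
  prime (Z.of_nat p) -> prim_root p r -> Nat.Odd l ->
  p = (2 * c * l + 1)%nat -> (i < l)%nat -> (i' < l)%nat ->
  rsum l (fun a =>
    trace_sum (2 * c) l (signed_re p r) (a + i) * trace_sum (2 * c) l (signed_re p r) (a + i') +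
    trace_sum (2 * c) l (signed_im p r) (a + i) * trace_sum (2 * c) l (signed_im p r) (a + i')) =
  if Nat.eqb i i' then INR p else 0.
Proof.
  intros Hp Hr Hl Hpc Hi Hi'.
  assert (Hp1 : (1 < Z.of_nat p)%Z) by now destruct Hp.
  assert (Hc : (0 < c)%nat) by nia.
  set (q := (2 * c)%nat) in *.
  assert (Hq : (q * l = p - 1)%nat) by lia.
  assert (Hper : forall u, signed_re p r (u + q * l)%nat = signed_re p r u /\
                           signed_im p r (u + q * l)%nat = signed_im p r u).
  { intros u; rewrite Hq; apply (signed_periodic p (c * l)); auto; unfold q in *; lia. }
  rewrite rsum_plus, !trace_sum_correlation by (intros; apply Hper).
  rewrite <- rsum_plus.
  transitivity (rsum q (fun j => (if Nat.eqb j 0 then (if Nat.eqb i i' then INR p else 0) else 0) +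
                                 - (-1) ^ (i + i') * (-1) ^ j)).
  - apply rsum_ext; intros j Hj.
    rewrite <- rsum_plus.
    rewrite (rsum_ext _ _ (fun u => (-1) ^ ((i + l) + (i' + (j + 1) * l)) *
      fst (zeta_pow p (r ^ Z.of_nat u *
        (r ^ Z.of_nat (i + l) - r ^ Z.of_nat (i' + (j + 1) * l)))))).
    2: { intros u _; rewrite <- signed_mul.
         now rewrite !Nat.add_assoc. }
    rewrite rsum_scal, Hq, sum_cos_prim_root by assumption.
    replace ((-1) ^ (i + l + (i' + (j + 1) * l))) with ((-1) ^ (i + i') * (-1) ^ j).
    2: { replace (i + l + (i' + (j + 1) * l))%nat with (i + i' + (j + 2) * l)%nat by ring.
         rewrite !pow_add, pow_m1_mul_odd, pow_add by assumption; ring. }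
    destruct (Z.eqb_spec ((r ^ Z.of_nat (i + l) - r ^ Z.of_nat (i' + (j + 1) * l))
                            mod Z.of_nat p) 0) as [E|E].
    (* The exponents i + l and i' + (j+1)l agree modulo ql. Hence l divides i - i', which forces i =
       i', and then q divides j < q, which forces j = 0. *)
    + apply Zmod_divide in E; [|lia]; apply eqmod_divide in E; [|lia].
      apply prim_root_pow_eq in E; [|assumption|assumption].
      rewrite <- Hq in E; apply (f_equal Z.of_nat) in E.
      rewrite !Nat2Z.inj_mod in E; apply eqmod_divide in E; [|nia].
      destruct E as [k Hk].
      assert (Hk' : (Z.of_nat i - Z.of_nat i' = (k * Z.of_nat q + Z.of_nat j) * Z.of_nat l)%Z)
        by lia.
      assert (k * Z.of_nat q + Z.of_nat j = 0)%Z by nia.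
      assert (k = 0)%Z by nia.
      assert (i = i') by nia; assert (j = 0)%nat by nia; subst.
      rewrite !Nat.eqb_refl; replace (i' + i')%nat with (2 * i')%nat by lia.
      rewrite pow_1_even; simpl; ring.
    + destruct (Nat.eqb_spec j 0) as [->|]; [|ring].
      destruct (Nat.eqb_spec i i') as [->|]; [|ring].
      exfalso; apply E; simpl (0 + 1)%nat; rewrite Nat.mul_1_l, Z.sub_diag; apply Zmod_0_l.
  - rewrite rsum_plus, rsum_delta, rsum_scal by lia.
    unfold q; rewrite rsum_alternating; ring.
Qed.

(** Each sigma^s(z) is (-1)^s A (1 - zeta^(r^s)). As l is odd, the signs alternate along the 2c
    terms and the contributions of the constant 1 cancel. The zero second component records that x
    is real. *)
Lemma sigma_x_eq (p l c : nat) (r lam : Z) (t : nat) :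
  prime (Z.of_nat p) -> prim_root p r -> Nat.Odd l -> p = (2 * c * l + 1)%nat ->
  ((lam * (r - 1)) mod Z.of_nat p = 1 mod Z.of_nat p)%Z ->
  (sigma_x p l r lam t, 0) =
  Cmul (sigma_A p r lam 0) (- trace_sum (2 * c) l (signed_re p r) t,
                            - trace_sum (2 * c) l (signed_im p r) t).
Proof.
  intros Hp Hr Hl Hpc Hlam; unfold sigma_x.
  assert (Hp1 : (1 < Z.of_nat p)%Z) by now destruct Hp.
  assert (Hh : p = (2 * (c * l) + 1)%nat) by lia.
  replace ((p - 1) / l)%nat with (2 * c)%nat by
    (replace (p - 1)%nat with (2 * c * l)%nat by lia; rewrite Nat.div_mul; nia).
  set (X := fun t => Csum (2 * c) (fun j => sigma_z p r lam (t + (j + 1) * l))).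
  (* Shifting t by cl leaves the sum unchanged, yet conjugates every term; the imaginary part
     therefore equals its own negative. *)
  assert (Hreal : snd (X t) = 0).
  { set (Y := trace_sum (2 * c) l (fun s => snd (sigma_z p r lam s))).
    assert (HXY : snd (X t) = Y t) by (unfold X; now rewrite Csum_eq_rsum).
    assert (HY : Y (t + c * l)%nat = Y t).
    { apply trace_sum_periodic; intros u.
      replace (u + 2 * c * l)%nat with (u + c * l + c * l)%nat by ring.
      rewrite !(sigma_z_half p (c * l)) by assumption; simpl; ring. }
    assert (HY' : Y (t + c * l)%nat = - 1 * Y t).
    { unfold Y, trace_sum; rewrite <- rsum_scal; apply rsum_ext; intros j _.
      replace (t + c * l + (j + 1) * l)%nat with (t + (j + 1) * l + c * l)%nat by ring.
      rewrite (sigma_z_half p (c * l)) by assumption; simpl; ring. }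
    lra. }
  change (Csum (2 * c) _) with (X t).
  rewrite <- Hreal, <- surjective_pairing; unfold X.
  rewrite (Csum_ext _ _ (fun j => Cmul (sigma_A p r lam 0)
    (Cmul ((-1) ^ (t + (j + 1) * l), 0)
          (Csub C1 (zeta_pow p (r ^ Z.of_nat (t + (j + 1) * l))))))).
  - rewrite Csum_scal, Csum_eq_rsum; f_equal.
    assert (Hsign : rsum (2 * c) (fun j => (-1) ^ (t + (j + 1) * l)) = 0).
    { rewrite (rsum_ext _ _ (fun j => (-1) ^ S t * (-1) ^ j)).
      - rewrite rsum_scal, rsum_alternating; ring.
      - intros j _; rewrite pow_add, pow_m1_mul_odd, pow_add by assumption; simpl; ring. }
    unfold Cmul, Csub, C1; cbn [fst snd]; f_equal.
    + rewrite (rsum_ext _ _ (fun j => (-1) ^ (t + (j + 1) * l) +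
                                   - 1 * signed_re p r (t + (j + 1) * l)))
        by (intros; unfold signed_re; ring).
      rewrite rsum_plus, Hsign, rsum_scal; unfold trace_sum; ring.
    + rewrite (rsum_ext _ _ (fun j => - 1 * signed_im p r (t + (j + 1) * l)))
        by (intros; unfold signed_im; ring).
      rewrite rsum_scal; unfold trace_sum; ring.
  - intros j _.
    transitivity (Cmul (sigma_A p r lam (t + (j + 1) * l))
                       (Csub C1 (zeta_pow p (r ^ Z.of_nat (t + (j + 1) * l))))); [reflexivity|].
    rewrite (sigma_A_sign p (c * l)) by assumption; ring.
Qed.

(** Write the two conjugates of x as AS and AS'. Both being real, their product is the real part of
    AS times the conjugate of AS', that is |A|^2 = p times the quantity summed in
    [signed_trace_orthogonal]. *)
Lemma sigma_x_orthogonal (p l c : nat) (r lam : Z) (i i' : nat) :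
  prime (Z.of_nat p) -> prim_root p r -> Nat.Odd l -> p = (2 * c * l + 1)%nat ->
  ((lam * (r - 1)) mod Z.of_nat p = 1 mod Z.of_nat p)%Z ->
  (i < l)%nat -> (i' < l)%nat ->
  rsum l (fun a => sigma_x p l r lam (a + i) * sigma_x p l r lam (a + i')) =
  if Nat.eqb i i' then INR p ^ 2 else 0.
Proof.
  intros Hp Hr Hl Hpc Hlam Hi Hi'.
  transitivity (INR p * (if Nat.eqb i i' then INR p else 0));
    [|destruct (Nat.eqb i i'); ring].
  rewrite <- (signed_trace_orthogonal p l c r i i') by assumption.
  rewrite <- rsum_scal; apply rsum_ext; intros a _.
  pose proof (sigma_x_eq p l c r lam (a + i) Hp Hr Hl Hpc Hlam) as E.
  pose proof (sigma_x_eq p l c r lam (a + i') Hp Hr Hl Hpc Hlam) as E'.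
  assert (Hh : p = (2 * (c * l) + 1)%nat) by lia.
  rewrite <- (Cnorm2_sigma_A p (c * l) r lam Hp Hr Hh).
  generalize dependent (2 * c)%nat; intros d _ E E'.
  destruct (sigma_A p r lam 0) as [x y]; unfold Cmul, Cnorm2 in *; cbn [fst snd] in *.
  injection E as E1 E2; injection E' as E1' E2'.
  (* The product of the two vanishing imaginary parts is added to complete the real product to |A|^2
     (Re S Re S' + Im S Im S'). *)
  pose proof (f_equal2 Rmult E2 E2'); rewrite E1, E1'; lra.
Qed.

(** * The orthonormal basis *)

(** Needed for the square root in [phi_beta] to square back to [tau_beta]. *)
Lemma tau_beta_nonneg (p m b : nat) : (0 < p)%nat -> 0 <= tau_beta p m b.
Proof.
  intros Hp; rewrite tau_beta_sin by assumption.
  assert (0 < INR (kk m)) by (apply lt_0_INR, Nat.neq_0_lt_0, Nat.pow_nonzero; lia).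
  assert (0 < INR p) by now apply lt_0_INR.
  apply Rmult_le_pos; [|apply Rle_0_sqr].
  apply Rmult_le_pos; [apply Rmult_le_pos; [lra|]|];
    apply Rlt_le, Rinv_0_lt_compat; [assumption|now apply pow_lt].
Qed.

(* Row j * l + i holds the coordinates of phi_beta(w_j sigma^i(x)). *)
Definition phi_basis (p l m : nat) (r lam : Z) (q idx : nat) : R :=
  sqrt (tau_beta p m (idx mod kk m)) *
  (tau_w m (q / l) (idx mod kk m) * sigma_x p l r lam (idx / kk m + q mod l)).

(** Splitting the coordinate index as a k + b factors the inner product into a sum over a from K and
    a sum over b from L; the p^2 of the first cancels the p^(-2) carried by beta. *)
Lemma phi_basis_orthogonal (p l m c : nat) (r lam : Z) :
  prime (Z.of_nat p) -> prim_root p r -> Nat.Odd l -> p = (2 * c * l + 1)%nat ->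
  ((lam * (r - 1)) mod Z.of_nat p = 1 mod Z.of_nat p)%Z -> (3 <= m)%nat ->
  orthogonal (nn m l) (phi_basis p l m r lam).
Proof.
  intros Hp Hr Hl Hpc Hlam Hm q q' Hq Hq'; unfold nn in *.
  assert (Hl0 : (0 < l)%nat) by (destruct Hl; lia).
  assert (Hk : (0 < kk m)%nat) by (apply Nat.neq_0_lt_0, Nat.pow_nonzero; lia).
  rewrite (Nat.mul_comm (kk m) l), rsum_mul.
  transitivity (rsum l (fun a =>
    (sigma_x p l r lam (a + q mod l) * sigma_x p l r lam (a + q' mod l)) *
    rsum (kk m) (fun b => tau_beta p m b * (tau_w m (q / l) b * tau_w m (q' / l) b)))).
  - apply rsum_ext; intros a _; rewrite <- rsum_scal; apply rsum_ext; intros b Hb.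
    unfold phi_basis.
    replace ((a * kk m + b) mod kk m)%nat with b
      by (rewrite Nat.add_comm, Nat.Div0.mod_add, Nat.mod_small; auto).
    replace ((a * kk m + b) / kk m)%nat with a
      by (rewrite Nat.div_add_l, Nat.div_small; lia).
    rewrite <- (sqrt_sqrt (tau_beta p m b)) at 3 by (apply tau_beta_nonneg; lia); ring.
  - rewrite rsum_scal_r, tau_w_orthogonal; [|lia|assumption| |];
      [|apply Nat.Div0.div_lt_upper_bound; lia..].
    rewrite (sigma_x_orthogonal p l c) by (auto; apply Nat.mod_upper_bound; lia).
    assert (Hp0 : 0 < INR p) by (apply lt_0_INR; lia).
    assert (Hdm : q = q' <-> (q / l = q' / l /\ q mod l = q' mod l)%nat).
    { split; [now intros ->|intros [E1 E2]].
      now rewrite (Nat.div_mod q l), (Nat.div_mod q' l), E1, E2 by lia. }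
    destruct (Nat.eqb_spec q q') as [E|E],
      (Nat.eqb_spec (q / l) (q' / l)) as [E1|E1],
      (Nat.eqb_spec (q mod l) (q' mod l)) as [E2|E2]; try tauto; try ring.
    field; lra.
Qed.

Lemma row_phi_basis (p l m : nat) (r lam : Z) (j i idx : nat) : (i < l)%nat ->
  row (nn m l) (phi_basis p l m r lam) (j * l + i) idx =
  phi_beta p l m (fun a b => tau_w m j b * sigma_x p l r lam (a + i)) idx.
Proof.
  intros Hi; unfold row, phi_beta, phi_basis.
  rewrite Nat.div_add_l, Nat.div_small, Nat.add_0_r by lia.
  now rewrite (Nat.add_comm (j * l)), Nat.Div0.mod_add, (Nat.mod_small i l) by lia.
Qed.

Lemma phi_beta_plus (p l m : nat) (e e' : nat -> nat -> R) (idx : nat) :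
  phi_beta p l m e idx + phi_beta p l m e' idx =
  phi_beta p l m (fun a b => e a b + e' a b) idx.
Proof. unfold phi_beta; destruct (idx <? nn m l)%nat; ring. Qed.

Lemma phi_beta_minus (p l m : nat) (e e' : nat -> nat -> R) (idx : nat) :
  phi_beta p l m e idx - phi_beta p l m e' idx =
  phi_beta p l m (fun a b => e a b - e' a b) idx.
Proof. unfold phi_beta; destruct (idx <? nn m l)%nat; ring. Qed.

(* In the order j * l + i the generators of M are e_0 + e_1 and e_q - e_(q+1); those of
   the second kind with q = l - 1 (mod l) are the w_j sigma^(l-1)(x) - w_(j+1) x. *)
Lemma gen_vec_rows (p l m : nat) (r lam : Z) (v : nat -> R) : (1 < l)%nat ->
  let Q := phi_basis p l m r lam in let n := nn m l in
  gen_vec p l m r lam v <->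
  v = (fun j => row n Q 0 j + row n Q 1 j) \/
  exists q, (S q < n)%nat /\ v = (fun j => row n Q q j - row n Q (S q) j).
Proof.
  intros Hl Q n.
  assert (E1 : phi_beta p l m (gen1 p l m r lam) = (fun j => row n Q 0 j + row n Q 1 j)).
  { apply functional_extensionality; intros idx.
    unfold n, Q; change 0%nat with (0 * l + 0)%nat at 1; change 1%nat with (0 * l + 1)%nat at 1.
    rewrite !row_phi_basis, phi_beta_plus by lia.
    unfold phi_beta, gen1; destruct (_ <? _)%nat; [rewrite Nat.add_0_r; ring|reflexivity]. }
  assert (E2 : forall i, phi_beta p l m (gen2 p l m r lam i) =
    (fun j => row n Q (i * l + (l - 1)) j - row n Q (S (i * l + (l - 1))) j)).
  { intros i; apply functional_extensionality; intros idx; unfold n, Q.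
    replace (S (i * l + (l - 1))) with ((i + 1) * l + 0)%nat by lia.
    rewrite !row_phi_basis, phi_beta_minus by lia.
    unfold phi_beta, gen2; now rewrite Nat.add_0_r. }
  assert (E3 : forall j i, (i + 2 <= l)%nat -> phi_beta p l m (gen3 p l m r lam j i) =
    (fun idx => row n Q (j * l + i) idx - row n Q (S (j * l + i)) idx)).
  { intros j i Hi; apply functional_extensionality; intros idx; unfold n, Q.
    replace (S (j * l + i)) with (j * l + (i + 1))%nat by lia.
    rewrite !row_phi_basis, phi_beta_minus by lia.
    unfold phi_beta, gen3; rewrite Nat.add_assoc.
    destruct (_ <? _)%nat; [ring|reflexivity]. }
  unfold gen_vec; split.
  - intros [->|[[i [Hi ->]]|[j [i [Hj [Hi ->]]]]]].
    + left; exact E1.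
    + right; exists (i * l + (l - 1))%nat; split; [unfold n, nn; nia|apply E2].
    + right; exists (j * l + i)%nat; split; [unfold n, nn; nia|now apply E3].
  - intros [->|[q [Hq ->]]]; [now left|right].
    unfold n, nn in Hq.
    pose proof (Nat.mod_upper_bound q l).
    assert (Hqdm : q = (q / l * l + q mod l)%nat)
      by (rewrite Nat.mul_comm; apply Nat.div_mod; lia).
    set (j := (q / l)%nat) in *; set (i := (q mod l)%nat) in *; clearbody i j.
    destruct (Nat.eq_dec i (l - 1)) as [->|Hi].
    + left; exists j; split; [nia|now rewrite E2, <- Hqdm].
    + right; exists j, i; split; [nia|split; [lia|]].
      now rewrite E3, <- Hqdm by lia.
Qed.

Theorem theorem9 (l p m : nat) (r lam : Z)
  (hl1 : (1 < l)%nat) (hlodd : Nat.Odd l)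
  (hp : prime (Z.of_nat p)) (hpl : (p mod l = 1)%nat)
  (hr : prim_root p r)
  (hlam : ((lam * (r - 1)) mod Z.of_nat p = 1 mod Z.of_nat p)%Z)
  (hm : (3 <= m)%nat) :
  exists Q : nat -> nat -> R,
    orthogonal (nn m l) Q /\
    forall v : nat -> R,
      Zspan (gen_vec p l m r lam) v <->
      exists d : nat -> Z, in_Dn (nn m l) d /\ v = vec_mul (nn m l) d Q.
Proof.
  (* If (p - 1)/l were odd, p would be even because l is odd, hence p = 2, contradicting 1 < l <= p
     - 1. *)
  assert (Hpc : exists c, p = (2 * c * l + 1)%nat).
  { pose proof (Nat.div_mod p l) as Hdm; rewrite hpl in Hdm.
    set (d := (p / l)%nat) in *.
    destruct hlodd as [k Hk].
    destruct (Nat.Even_or_Odd d) as [[c Hc]|[c Hc]]; [exists c; nia|exfalso].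
    assert (H2 : (2 | Z.of_nat p)%Z).
    { exists (Z.of_nat (c * l + k + 1)); nia. }
    apply prime_divisors in H2; [|assumption].
    assert (l <= p - 1)%nat by nia; lia. }
  destruct Hpc as [c Hpc].
  exists (phi_basis p l m r lam); split; [now apply (phi_basis_orthogonal p l m c)|].
  apply Zspan_Dn.
  - unfold nn; assert (0 < kk m)%nat by (apply Nat.neq_0_lt_0, Nat.pow_nonzero; lia); nia.
  - intros v; now apply gen_vec_rows.
Qed.
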